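(* Let $\Sigma\in\mathbb{R}^{k\times k}$ be symmetric positive definite, and assume there is at least one allocation $\underline n$ satisfying $\mathbf{B}(\underline n)$ with $\operatorname{supp}(a)\subseteq\bigcup\{I\in\mathcal I:n_I>0\}$. Then \[ \inf_{\hat\theta\in\Theta_B}\ \sup_{P\in\mathcal P_\Sigma}\ \mathbb{E}_P\big[(\hat\theta-a^\top\mathbb{E}_P[X])^2\big]\;=\;\operatorname{Var}\big(\hat\theta_{\mathrm{MultiPPI}(\Sigma)}\big)\;=\;\mathcal V_B, \] where the variance is computed under any $P\in\mathcal P_\Sigma$ (it is the same for all such $P$).
   Context: Let $X=(X_1,\dots,X_k)$ be a random vector in $\mathbb{R}^k$ with finite second moments, and fix $a\in\mathbb{R}^k$, $a\neq 0$; the target is $\theta^*=a^\top\mathbb{E}[X]$. Fix a collection $\mathcal I$ of nonempty subsets $I\subseteq\{1,\dots,k\}$. For $I\in\mathcal I$, $P_I:\mathbb{R}^k\to\mathbb{R}^{|I|}$ is the coordinate projection onto the coordinates in $I$ (so $P_I^\top$ is zero-padding), $X_I=P_IX$, and $\Sigma_I=P_I\Sigma P_I^\top$ (principal submatrix). Each $I$ has a cost vector $c_I\in\mathbb{R}^m_{\ge0}$ and there is a budget $B\in\mathbb{R}^m_{\ge0}$; vector inequalities are componentwise. An allocation is $\underline n=(n_I)_{I\in\mathcal I}$ with $n_I\in\mathbb{Z}_{\ge0}$; it satisfies the budget, written $\mathbf{B}(\underline n)$, if $\sum_{I}n_Ic_I\le B$. Given $\underline n$, the data are $\{X_I^{(I,j)}:I\in\mathcal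 I,\,1\le j\le n_I\}$, where the $X^{(I,j)}$ are mutually independent copies of $X$ and only the coordinates $I$ of $X^{(I,j)}$ are observed. A budget-satisfying estimator is any measurable function of such data for some $\underline n$ with $\mathbf{B}(\underline n)$; $\Theta_B$ denotes the set of all of them (no linearity or unbiasedness imposed). $\mathcal P_\Sigma$ is the set of all distributions on $\mathbb{R}^k$ with covariance matrix $\Sigma$. For weights $\underline\lambda=(\lambda_I)_{I\in\mathcal I}$, $\lambda_I\in\mathbb{R}^{|I|}$, define $\hat\theta(\underline n,\underline\lambda)=\sum_{I:n_I>0}\frac1{n_I}\sum_{j=1}^{n_I}\lambda_I^\top X_I^{(I,j)}$. The unbiasedness condition $\mathbf U(\underline n,\underline\lambda)$ is $\sum_{I:n_I>0}P_I^\top\lambda_I=a$ (equivalently, $\mathbb{E}\hat\theta(\underline n,\underline\lambda)=a^\top\mathbb{E}X$ for every distribution with finite second moments). $\hat\theta_{\mathrm{MultiPPI}(\Sigma)}$ is $\hat\theta(\underline n,\underline\lambda)$ for a pair $(\underline n,\underline\lambda)$ minimizing $\sum_{I:n_I>0}\frac1{n_I}\lambda_I^\top\Sigma_I\lambda_I$ subject to $\mathbf B(\underline n)$ and $\mathbf U(\underline n,\underline\lambda)$. Finally \[ \mathcal V_B=\min\Big\{a^\top S(\underline n)a:\ \underline n\in\mathbb{Z}_{\ge0}^{\mathcal I},\ \mathbf B(\underline n),\ \operatorname{supp}(a)\subseteq\textstyle\bigcup\{I:n_I>0\}\Big\},\qquad S(\underline n)=\Big(\sum_{I\in\mathcal I}n_IP_I^\top\Sigma_I^{-1}P_I\Big)^\dagger,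 \] with $\dagger$ the Moore–Penrose pseudo-inverse.
   Formalization: Since zero costs are allowed, the minimum defining V_B and the minimizing pair defining MultiPPI may fail to exist (k=1, zero cost: values 1/n); V_B is therefore read as an infimum, and the variance identity is stated for every minimizing pair, whenever one exists. *)

(* Defs.v *)
From HB Require Import structures.
From mathcomp Require Import all_boot all_order all_algebra.
From mathcomp Require Import all_classical all_reals all_analysis.
Set Implicit Arguments. Unset Strict Implicit. Unset Printing Implicit Defensive.
Import Order.TTheory GRing.Theory Num.Theory.
Local Open Scope classical_set_scope.
Local Open Scope ring_scope.

Section MultiPPI.
Variables (R : realType) (k m : nat).

Definition sym_posdef (S : 'M[R]_k) : Prop :=
  S^T = S /\ forall v : 'cV[R]_k, v != 0 -> 0 < (v^T *m S *m v) 0 0.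

(* Moore--Penrose pseudo-inverse (the unique matrix satisfying the four
   Penrose equations; it exists and is unique for every real matrix). *)
Definition is_MPinv (A B : 'M[R]_k) : Prop :=
  [/\ A *m B *m A = A, B *m A *m B = B,
      (A *m B)^T = A *m B & (B *m A)^T = B *m A].
Definition MPinv (A : 'M[R]_k) : 'M[R]_k := xget 0 [set B | is_MPinv A B].

Definition projI (I : {set 'I_k}) : 'M[R]_(#|I|, k) :=
  \matrix_(r < #|I|, c < k) (c == enum_val r)%:R.
Definition SigI (S : 'M[R]_k) (I : {set 'I_k}) : 'M[R]_#|I| :=
  projI I *m S *m (projI I)^T.

Variables (coll : {set {set 'I_k}}) (c : {set 'I_k} -> 'I_m -> R)
  (B : 'I_m -> R).

(* allocations: n : {set 'I_k} -> nat, only the values on coll matter *)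
Definition budget (n : {set 'I_k} -> nat) : Prop :=
  forall t : 'I_m, \sum_(I in coll) (n I)%:R * c I t <= B t.

Definition supp_covered (a : 'cV[R]_k) (n : {set 'I_k} -> nat) : Prop :=
  forall i : 'I_k, a i 0 != 0 -> exists2 I, I \in coll & (0 < n I)%N /\ i \in I.

Definition Smat (S : 'M[R]_k) (n : {set 'I_k} -> nat) : 'M[R]_k :=
  MPinv (\sum_(I in coll) (n I)%:R *: ((projI I)^T *m invmx (SigI S I) *m projI I)).

Definition VB (S : 'M[R]_k) (a : 'cV[R]_k) : \bar R :=
  ereal_inf [set ((a^T *m Smat S n *m a) 0 0)%:E | n in
             [set n | budget n /\ supp_covered a n]].

(* the data layout: one position per sample (I,j), 1 <= j <= n_I, I in coll;
   position p carries the observed index set pattern`_p *)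
Definition pattern (n : {set 'I_k} -> nat) : seq {set 'I_k} :=
  flatten [seq nseq (n J) J | J <- enum coll].
Definition ndata (n : {set 'I_k} -> nat) : nat := size (pattern n).
Definition patI (n : {set 'I_k} -> nat) (p : 'I_(ndata n)) : {set 'I_k} :=
  tnth (in_tuple (pattern n)) p.

(* zero-padded observation P_I^T X_I *)
Definition maskI (I : {set 'I_k}) (x : k.-tuple R) : k.-tuple R :=
  [tuple if i \in I then tnth x i else 0 | i < k].

Definition colv (x : k.-tuple R) : 'cV[R]_k := \col_i tnth x i.

Definition in_PSigma (S : 'M[R]_k) (mu : probability (k.-tuple R) R) : Prop :=
  (forall i : 'I_k, (fun x : k.-tuple R => tnth x i) \in Lfun mu 2%:E) /\
  forall i j : 'I_k,
    covariance mu (fun x : k.-tuple R => tnth x i) (fun x => tnth x j)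
    = (S i j)%:E.

Definition theta (a : 'cV[R]_k) (mu : probability (k.-tuple R) R) : R :=
  \sum_(i < k) a i 0 * fine ('E_mu[fun x : k.-tuple R => tnth x i])%E.

Definition iid_copies d (Omega : measurableType d) (P : probability Omega R)
  (mu : probability (k.-tuple R) R) N (X : 'I_N -> Omega -> k.-tuple R) : Prop :=
  [/\ forall p, measurable_fun setT (X p),
      forall p (A : set (k.-tuple R)), measurable A -> P (X p @^-1` A) = mu A &
      forall A : 'I_N -> set (k.-tuple R), (forall p, measurable (A p)) ->
        P (\bigcap_(p in [set: 'I_N]) (X p @^-1` A p))
        = (\prod_(p < N) P (X p @^-1` A p))%E].

Definition obs n d (Omega : measurableType d)
  (X : 'I_(ndata n) -> Omega -> k.-tuple R) (w : Omega)
  : (ndata n).-tuple (k.-tuple R) :=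
  [tuple maskI (patI p) (X p w) | p < ndata n].

Definition worst_mse (S : 'M[R]_k) (a : 'cV[R]_k) (n : {set 'I_k} -> nat)
  (f : (ndata n).-tuple (k.-tuple R) -> R) : \bar R :=
  ereal_sup [set r | exists d (Omega : measurableType d)
     (P : probability Omega R) (mu : probability (k.-tuple R) R)
     (X : 'I_(ndata n) -> Omega -> k.-tuple R),
     [/\ in_PSigma S mu, iid_copies P mu X &
         r = (\int[P]_w (((f (obs X w) - theta a mu) ^+ 2)%:E))%E]].

Definition minimax_risk (S : 'M[R]_k) (a : 'cV[R]_k) : \bar R :=
  ereal_inf [set r | exists n, budget n /\
     exists f : (ndata n).-tuple (k.-tuple R) -> R,
       measurable_fun setT f /\ r = worst_mse S a f].

Definition weights := forall I : {set 'I_k}, 'cV[R]_#|I|.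

Definition unbiasedU (a : 'cV[R]_k) (n : {set 'I_k} -> nat) (lam : weights) : Prop :=
  \sum_(I in coll | (0 < n I)%N) (projI I)^T *m lam I = a.

Definition mppi_obj (S : 'M[R]_k) (n : {set 'I_k} -> nat) (lam : weights) : R :=
  \sum_(I in coll | (0 < n I)%N) (n I)%:R^-1 * ((lam I)^T *m SigI S I *m lam I) 0 0.

Definition is_MultiPPI (S : 'M[R]_k) (a : 'cV[R]_k) (n : {set 'I_k} -> nat)
  (lam : weights) : Prop :=
  [/\ budget n, unbiasedU a n lam &
      forall n' lam', budget n' -> unbiasedU a n' lam' ->
        mppi_obj S n lam <= mppi_obj S n' lam'].

(* hat theta(n, lam) = sum_{I : n_I > 0} 1/n_I sum_j lam_I^T X_I^{(I,j)},
   as a function of the data set *)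
Definition mppi_est (n : {set 'I_k} -> nat) (lam : weights)
  (D : (ndata n).-tuple (k.-tuple R)) : R :=
  \sum_(p < ndata n) (n (patI p))%:R^-1 *
     ((lam (patI p))^T *m projI (patI p) *m colv (tnth D p)) 0 0.

End MultiPPI.

(* Main.v *)
Require Import Defs.
From HB Require Import structures.
From mathcomp Require Import all_boot all_order all_algebra.
From mathcomp Require Import all_classical all_reals all_analysis.
From mathcomp Require Import measurable_realfun normal_distribution ring lra.
Set Implicit Arguments. Unset Strict Implicit. Unset Printing Implicit Defensive.
Import Order.TTheory GRing.Theory Num.Theory.
Local Open Scope classical_set_scope.
Local Open Scope ring_scope.

(** Upper bound: for a covered allocation [n], the weights
[n_I Sigma_I^-1 P_I h] with [h = S(n) a] are unbiased and, by completing the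
square, optimal with objective value [a^T S(n) a]; the variance of a linear
unbiased estimator depends on the distribution only through [Sigma].

Lower bound: a one-parameter family suffices. Write [Sigma = L L^T], fix a
direction [h], and let [X = t h + L Z] with [Z] standard Gaussian and [t] real.
On the coordinates [I], moving [t] by [u] has the same effect as translating [Z]
by [u L^T P_I^T Sigma_I^-1 P_I h], so the data for [t + u] are the data for [t]
read at a translated noise; the squared lengths of these translations add up to
[u^2 s], with [s = h^T M h] and [M] the information matrix. If the risk is at
most [K] for all [t], the mean [m t] of the estimator stays within [sqrt K] of
[t b], [b = a^T h], whereas by Cauchy-Schwarz on the likelihood ratio (as in the
Hammersley-Chapman-Robbins bound) it grows by at most
[sqrt (K (exp (s u^2) - 1))] when [t] grows by [u]. Hence [u b] is at most this
increment for every [u], and [u -> 0] gives [b^2 <= K s]. Taking [h = S(n) a]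
yields [K >= a^T S(n) a]; if [a] is not covered, [h] can be chosen with [s = 0]
and [b <> 0], so that the worst risk is infinite. *)

(** * Linear algebra of allocations *)

Section LinearAlgebra.
Variable R : realType.

Lemma sqnorm_sum k (v : 'cV[R]_k) : (v^T *m v) 0 0 = \sum_i v i 0 ^+ 2.
Proof. by rewrite mxE; apply: eq_bigr => i _; rewrite mxE expr2. Qed.

Lemma sqnorm_eq0 k (v : 'cV[R]_k) : (v^T *m v) 0 0 = 0 -> v = 0.
Proof.
rewrite sqnorm_sum => /eqP; rewrite psumr_eq0; last by move=> i _; rewrite sqr_ge0.
move=> /allP v0; apply/matrixP => i j; rewrite ord1 mxE.
by apply/eqP; rewrite -sqrf_eq0 (eqP (v0 i _))// mem_index_enum.
Qed.

(** If [v F F^T = 0], then [v F] has squared norm [v F F^T v^T = 0], and freeness of the rows of [F]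
    gives [v = 0]. *)
Lemma gram_unitmx r k (F : 'M[R]_(r, k)) : row_free F -> F *m F^T \in unitmx.
Proof.
move=> freeF; rewrite -row_free_unit -kermx_eq0; apply/rowV0P => v /sub_kermxP.
move=> vF0; apply: (row_free_inj freeF); rewrite mul0mx.
apply/trmx_inj; rewrite trmx0; apply: sqnorm_eq0.
by rewrite trmxK trmx_mul !mulmxA -(mulmxA v) vF0 mul0mx mxE.
Qed.

(** The witness [F^T (F F^T)^-1 (C^T C)^-1 C^T] is a right inverse of [F] times a left inverse of
    [C]. Applied to a rank factorization, it gives every square matrix a pseudo-inverse, so that
    [MPinv] never takes its default value. *)
Lemma full_rank_factor_MPinv k r (C : 'M[R]_(k, r)) (F : 'M[R]_(r, k)) :
  row_full C -> row_free F -> exists X, is_MPinv (C *m F) X.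
Proof.
move=> fullC freeF.
have uF : F *m F^T \in unitmx by exact: gram_unitmx.
have uC : C^T *m C \in unitmx.
  rewrite -{2}[C]trmxK; apply: gram_unitmx.
  by rewrite /row_free mxrank_tr.
pose Fp := F^T *m invmx (F *m F^T); pose Cp := invmx (C^T *m C) *m C^T.
have FFp : F *m Fp = 1%:M by rewrite /Fp mulmxA mulmxV.
have CpC : Cp *m C = 1%:M by rewrite /Cp -mulmxA mulVmx.
have XA : (Fp *m Cp) *m (C *m F) = Fp *m F by rewrite -mulmxA (mulmxA Cp) CpC mul1mx.
have AX : (C *m F) *m (Fp *m Cp) = C *m Cp by rewrite -mulmxA (mulmxA F) FFp mul1mx.
have symV (G : 'M[R]_r) : G^T = G -> (invmx G)^T = invmx G.
  by move=> GT; rewrite trmx_inv GT.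
exists (Fp *m Cp); split.
- by rewrite AX -mulmxA (mulmxA Cp) CpC mul1mx.
- by rewrite XA -mulmxA (mulmxA F) FFp mul1mx.
- by rewrite AX /Cp !trmx_mul trmxK symV ?mulmxA// trmx_mul trmxK.
- by rewrite XA /Fp !trmx_mul trmxK symV ?mulmxA// trmx_mul trmxK.
Qed.

Lemma MPinvP k (A : 'M[R]_k) : is_MPinv A (MPinv A).
Proof. 
rewrite -{1}(mulmx_base A).
have [X AX] := full_rank_factor_MPinv (col_base_full A) (row_base_free A).
rewrite mulmx_base in AX *; exact: (xgetI _ AX).
Qed.

Lemma posdef_unitmx k (S : 'M[R]_k) : sym_posdef S -> S \in unitmx.
Proof.
move=> [_ S0]; rewrite -row_free_unit -kermx_eq0; apply/rowV0P => v /sub_kermxP vS.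
apply/eqP/negPn/negP => v0.
have vT0 : v^T != 0 by apply: contra v0 => /eqP vT; rewrite -[v]trmxK vT trmx0.
by have := S0 _ vT0; rewrite trmxK vS mul0mx mxE ltxx.
Qed.

Lemma posdef_ge0 k (S : 'M[R]_k) (v : 'cV[R]_k) :
  sym_posdef S -> 0 <= (v^T *m S *m v) 0 0.
Proof.
move=> [_ S0]; have [->|/S0 /ltW//] := eqVneq v 0.
by rewrite mulmx0 mxE.
Qed.

Lemma posdef_eq0 k (S : 'M[R]_k) (v : 'cV[R]_k) :
  sym_posdef S -> (v^T *m S *m v) 0 0 = 0 -> v = 0.
Proof.
by move=> [_ S0]; have [//|/S0 /gt_eqF + /eqP] := eqVneq v 0 => ->.
Qed.

Lemma posdef_inv k (S : 'M[R]_k) : sym_posdef S -> sym_posdef (invmx S).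
Proof.
move=> Spd; have uS := posdef_unitmx Spd; have [ST S0] := Spd; split.
  by rewrite trmx_inv ST.
move=> v v0; have : invmx S *m v != 0.
  by apply: contra v0 => /eqP Sv; rewrite -(mulKVmx uS v) Sv mulmx0.
by move=> /S0; rewrite trmx_mul trmx_inv ST -!mulmxA (mulKVmx uS).
Qed.

(** Induction on the dimension: the first row and column are split off and the induction hypothesis
    is applied to the Schur complement of the corner entry. *)
Lemma cholesky k (S : 'M[R]_k) : sym_posdef S -> exists A : 'M[R]_k, A *m A^T = S.
Proof.
elim: k S => [S _|k IH S]; first by exists 0; rewrite !flatmx0.
rewrite -[k.+1]/(1 + k)%N in S *; move=> [].
rewrite -[S]submxK; set a := ulsubmx S; set b := ursubmx S; set c := dlsubmx S.
set D := drsubmx S; rewrite tr_block_mx => /eq_block_mx[_ _ bc DT] S0.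
pose al := a 0 0; have aE : a = al%:M by rewrite [LHS]mx11_scalar.
have al0 : 0 < al.
  have := S0 (col_mx 1 0); rewrite tr_col_mx mul_row_block mul_row_col.
  rewrite trmx0 !mul0mx !mulmx0 !addr0 trmx1 mul1mx mulmx1; apply.
  rewrite col_mx_eq0 negb_and; apply/orP; left.
  by apply/eqP => /matrixP/(_ 0 0); rewrite !mxE => /eqP; rewrite oner_eq0.
have [|A' A'E] := IH (D - al^-1 *: (b^T *m b)).
  split=> [|v v0].
    by rewrite linearB linearZ /= trmx_mul trmxK DT.
  (* For fixed [v], this first block minimises the form of [S]; the minimum is the value at [v] of
     the form of the Schur complement. *)
  have := S0 (col_mx (- al^-1 *: (b *m v)) v).
  rewrite col_mx_eq0 negb_and v0 orbT => /(_ isT).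
  rewrite -mulmxA mul_block_col tr_col_mx mul_row_col.
  rewrite {1}aE mul_scalar_mx scalerA mulrN mulfV ?gt_eqF// scaleN1r addNr mulmx0 add0r.
  rewrite -bc -mulmxA; congr (_ < (_ *m _) _ _).
  by rewrite mulmxBl addrC -scalemxAr scaleNr -scalemxAl !mulmxA.
exists (block_mx (Num.sqrt al)%:M 0 ((Num.sqrt al)^-1 *: b^T) A').
have s0 : Num.sqrt al != 0 by rewrite gt_eqF// sqrtr_gt0.
rewrite tr_block_mx mulmx_block !trmx0 !mul0mx !mulmx0 !addr0 A'E.
rewrite tr_scalar_mx linearZ /= trmxK -scalar_mxM -expr2 sqr_sqrtr ?ltW//.
rewrite -aE mul_scalar_mx scalerA mulfV// scale1r -scalemxAl mul_mx_scalar.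
rewrite scalerA mulVf// scale1r bc -scalemxAl -scalemxAr scalerA -invfM.
by rewrite -expr2 sqr_sqrtr ?ltW// addrC subrK.
Qed.

End LinearAlgebra.

(** * Information matrix and optimal weights of an allocation *)

Section Allocation.
Variables (R : realType) (k : nat) (S : 'M[R]_k).
Hypothesis Spd : sym_posdef S.
Implicit Types (I : {set 'I_k}) (n : {set 'I_k} -> nat).

Lemma projIE I p (v : 'M[R]_(k, p)) r j : (projI R I *m v) r j = v (enum_val r) j.
Proof.
rewrite mxE (bigD1 (enum_val r))//= mxE eqxx mul1r big1 ?addr0// => i /negPf ir.
by rewrite mxE ir mul0r.
Qed.

Lemma projIK I : projI R I *m (projI R I)^T = 1%:M.
Proof.
by apply/matrixP => r s; rewrite projIE !mxE (inj_eq enum_val_inj).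
Qed.

Lemma projI_trE I (l : 'cV[R]_#|I|) i : i \notin I -> ((projI R I)^T *m l) i 0 = 0.
Proof.
move=> iI; rewrite mxE big1// => r _; rewrite !mxE.
have [ir|] := eqVneq i (enum_val r); last by rewrite mul0r.
by rewrite ir enum_valP in iI.
Qed.

Lemma projI_eq I (v w : 'cV[R]_k) i :
  projI R I *m v = projI R I *m w -> i \in I -> v i 0 = w i 0.
Proof.
move=> /matrixP vw iI; have := vw (enum_rank_in iI i) 0.
by rewrite !projIE enum_rankK_in.
Qed.

Lemma SigI_posdef I : sym_posdef (SigI S I).
Proof.
have [ST S0] := Spd; split; first by rewrite /SigI !trmx_mul trmxK ST mulmxA.
move=> v v0; have : (projI R I)^T *m v != 0.
  apply: contra v0 => /eqP Pv; rewrite -[v]mul1mx -projIK -mulmxA Pv.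
  by rewrite mulmx0.
by move=> /S0; rewrite trmx_mul trmxK /SigI !mulmxA.
Qed.

Variable coll : {set {set 'I_k}}.

(** The Fisher information about the mean when vectors with law [N(x, S)] are observed on each [I]
    exactly [n I] times; [Smat] is its pseudo-inverse. *)
Definition infomx n : 'M[R]_k :=
  \sum_(I in coll) (n I)%:R *: ((projI R I)^T *m invmx (SigI S I) *m projI R I).

Lemma infomx_sym n : (infomx n)^T = infomx n.
Proof.
rewrite /infomx linear_sum; apply: eq_bigr => I _.
by rewrite linearZ /= !trmx_mul trmxK trmx_inv (SigI_posdef I).1 mulmxA.
Qed.

Lemma infomxE n (h : 'cV[R]_k) : (h^T *m infomx n *m h) 0 0 =
  \sum_(I in coll) (n I)%:R *
    ((projI R I *m h)^T *m invmx (SigI S I) *m (projI R I *m h)) 0 0.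
Proof.
rewrite mulmx_sumr mulmx_suml summxE; apply: eq_bigr => I _.
by rewrite -scalemxAr -scalemxAl mxE trmx_mul !mulmxA.
Qed.

(** The quadratic form of the information at [h] is a sum of nonnegative terms, so each of them
    vanishes, and the blocks are definite. *)
Lemma infomx_ker n (h : 'cV[R]_k) I : infomx n *m h = 0 ->
  I \in coll -> (0 < n I)%N -> projI R I *m h = 0.
Proof.
move=> Mh Ic nI; have := infomxE n h; rewrite -mulmxA Mh mulmx0 mxE => /esym/eqP.
rewrite psumr_eq0 => [/allP/(_ I)|J _]; last first.
  by rewrite mulr_ge0// (posdef_ge0 _ (posdef_inv (SigI_posdef J))).
rewrite mem_index_enum Ic /= mulf_eq0 pnatr_eq0 eqn0Ngt nI /= => /(_ isT)/eqP.
exact: posdef_eq0 (posdef_inv (SigI_posdef I)).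
Qed.

Lemma infomx_range n (a : 'cV[R]_k) : supp_covered coll a n ->
  infomx n *m (Smat coll S n *m a) = a.
Proof.
move=> cov; rewrite /Smat -/(infomx n); set M := infomx n; set X := MPinv M.
have [MXM _ MXT _] := MPinvP M; rewrite -/X in MXM MXT.
(* [Q] is the orthogonal projection onto the range of [M]; the residual
   [a - Q a] lies in the kernel of [M], hence vanishes on the support of [a]. *)
rewrite mulmxA; set Q := M *m X.
have QQ : Q *m Q = Q by rewrite /Q mulmxA MXM.
have MQ : M *m Q = M by rewrite -[LHS]trmxK trmx_mul MXT infomx_sym MXM infomx_sym.
have Mr : M *m (a - Q *m a) = 0 by rewrite mulmxBr mulmxA MQ subrr.
have ra : ((a - Q *m a)^T *m a) 0 0 = 0.
  rewrite mxE big1// => i _; rewrite mxE.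
  have [->|/cov[I Ic [nI iI]]] := eqVneq (a i 0) 0; first by rewrite mulr0.
  rewrite (@projI_eq I _ 0) ?mxE ?mul0r//.
  by rewrite (infomx_ker Mr)// mulmx0.
apply/eqP; rewrite eq_sym -subr_eq0; apply/eqP; apply: sqnorm_eq0.
rewrite mulmxBr mxE ra add0r mxE mulmxA.
suff -> : (a - Q *m a)^T *m Q = 0 by rewrite mul0mx mxE oppr0.
by apply: trmx_inj; rewrite trmx_mul trmxK MXT mulmxBr mulmxA QQ subrr trmx0.
Qed.

(** The stationary point of the objective under the unbiasedness constraint, with a Lagrange
    multiplier proportional to [S(n) a]. The factor [n I] makes the weight zero where nothing is
    sampled. *)
Definition opt_weights n (a : 'cV[R]_k) : weights R k :=
  fun I => (n I)%:R *: (invmx (SigI S I) *m (projI R I *m (Smat coll S n *m a))).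

Lemma unbiasedU_covered n a (lam : weights R k) :
  unbiasedU coll a n lam -> supp_covered coll a n.
Proof.
move=> U i ai; have : exists2 I, (I \in coll) && (0 < n I)%N & i \in I.
  apply: contrapT => nI; case/negP : ai; rewrite -U summxE big1// => I IP.
  by rewrite projI_trE//; apply/negP => iI; apply: nI; exists I.
by move=> [I /andP[]]; exists I.
Qed.

Lemma opt_weights_unbiased n a : supp_covered coll a n ->
  unbiasedU coll a n (opt_weights n a).
Proof.
move=> cov; rewrite /unbiasedU -[RHS](infomx_range cov) /infomx mulmx_suml.
rewrite [RHS]big_mkcond [LHS]big_mkcondr big_mkcond /=; apply: eq_bigr => I _.
case: ifP => // _; rewrite /opt_weights; case: (posnP (n I)) => [->|_].
  by rewrite scale0r mul0mx.
by rewrite -scalemxAr -scalemxAl !mulmxA.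
Qed.

(** With [h = S(n) a], the factors [n_I] and [Sigma_I] cancel and leave the sum of [lam_I^T P_I h],
    which is [a^T h] by unbiasedness alone. Hence the pairing with the optimal weights is the same
    for all unbiased [lam]. *)
Lemma mppi_cross n a (lam : weights R k) : unbiasedU coll a n lam ->
  \sum_(I in coll | (0 < n I)%N)
    (n I)%:R^-1 * ((lam I)^T *m SigI S I *m opt_weights n a I) 0 0 =
  (a^T *m Smat coll S n *m a) 0 0.
Proof.
move=> U; rewrite -{2}U linear_sum /= -mulmxA mulmx_suml summxE.
apply: eq_bigr => I /andP[_ nI].
rewrite /opt_weights -scalemxAr mxE mulrA mulVf ?pnatr_eq0 -?lt0n// mul1r.
rewrite trmx_mul trmxK -mulmxA mulKVmx ?mulmxA//.
by apply: posdef_unitmx; exact: SigI_posdef.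
Qed.

Lemma opt_weights_obj n a : supp_covered coll a n ->
  mppi_obj coll S n (opt_weights n a) = (a^T *m Smat coll S n *m a) 0 0.
Proof. by move=> cov; exact: mppi_cross (opt_weights_unbiased cov). Qed.

Lemma mppi_obj_ge n a (lam : weights R k) : unbiasedU coll a n lam ->
  (a^T *m Smat coll S n *m a) 0 0 <= mppi_obj coll S n lam.
Proof.
move=> U; have cov := unbiasedU_covered U.
set V := (a^T *m _ *m a) 0 0; set lo := opt_weights n a.
have crossC I : ((lo I)^T *m SigI S I *m lam I) 0 0 = ((lam I)^T *m SigI S I *m lo I) 0 0.
  rewrite -[LHS](mxE trmx_key (fun i j => _ j i)) -/(trmx _) trmx_mul trmx_mul.
  by rewrite trmxK (SigI_posdef I).1 mulmxA.
have : 0 <= \sum_(I in coll | (0 < n I)%N)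
    (n I)%:R^-1 * ((lam I - lo I)^T *m SigI S I *m (lam I - lo I)) 0 0.
  apply: sumr_ge0 => I _; rewrite mulr_ge0 ?invr_ge0//.
  exact: posdef_ge0 (SigI_posdef I).
under eq_bigr => I _.
  have -> : ((lam I - lo I)^T *m SigI S I *m (lam I - lo I)) 0 0 =
    ((lam I)^T *m SigI S I *m lam I) 0 0 -
    (((lam I)^T *m SigI S I *m lo I) 0 0 + ((lam I)^T *m SigI S I *m lo I) 0 0)
    + ((lo I)^T *m SigI S I *m lo I) 0 0.
    rewrite -{2}crossC [(_ - _)^T]raddfB /= mulmxBl mulmxBl !mulmxBr.
    move: (_ *m lo I) (_ *m lam I) (_ *m lo I) (_ *m lam I) => w x y z.
    by rewrite !mxE; ring.
  rewrite mulrDr mulrBr (mulrDr (n I)%:R^-1).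
  over.
(* The nonnegative sum is now the objective at [lam], minus two cross terms equal to [V], plus the
   objective at [lo], also equal to [V]. *)
rewrite big_split /= sumrB big_split /= mppi_cross// -/V.
rewrite -[X in _ + X]/(mppi_obj coll S n lo) opt_weights_obj// -/V.
rewrite -/(mppi_obj coll S n lam); lra.
Qed.

End Allocation.

(** * Laws, square integrability and independence *)

Section Transfer.
Context d d' (T : measurableType d) (T' : measurableType d') (R : realType).
Local Open Scope ereal_scope.

(** Positive and negative parts are transported separately, so no integrability is assumed. The
    equality of laws is stated on measurable sets, the form in which [iid_copies] provides it. *)
Lemma integral_law (P : probability T R) (mu : probability T' R) (X : T -> T')
    (f : T' -> \bar R) :
  measurable_fun setT X -> measurable_fun setT f ->
  (forall A, measurable A -> P (X @^-1` A) = mu A) ->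
  \int[P]_w f (X w) = \int[mu]_x f x.
Proof.
move=> mX mf PX.
have H g : measurable_fun setT g -> (forall x, 0 <= g x) ->
    \int[P]_w (g \o X) w = \int[mu]_x g x.
  move=> mg g0.
  have := @ge0_integral_pushforward _ _ _ _ R X mX P setT g measurableT mg (fun x _ => g0 x).
  rewrite preimage_setT => <-.
  by apply: eq_measure_integral => A mA _; rewrite /= -PX.
rewrite integralE [RHS]integralE.
have Hp := H f^\+ (measurable_funepos mf) (funepos_ge0 f).
have Hn := H f^\- (measurable_funeneg mf) (funeneg_ge0 f).
by rewrite -Hp -Hn -(funepos_comp f X) -(funeneg_comp f X).
Qed.

Lemma expectation_law (P : probability T R) (mu : probability T' R) (X : T -> T')
    (f : T' -> R) :
  measurable_fun setT X -> measurable_fun setT f ->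
  (forall A, measurable A -> P (X @^-1` A) = mu A) ->
  'E_P[f \o X] = 'E_mu[f].
Proof.
move=> mX mf PX; rewrite unlock.
by apply: (integral_law (f := EFin \o f) mX _ PX); exact/measurable_EFinP.
Qed.

Lemma covariance_law (P : probability T R) (mu : probability T' R) (X : T -> T')
    (f g : T' -> R) :
  measurable_fun setT X -> measurable_fun setT f -> measurable_fun setT g ->
  (forall A, measurable A -> P (X @^-1` A) = mu A) ->
  covariance P (f \o X) (g \o X) = covariance mu f g.
Proof.
move=> mX mf mg PX; rewrite [in LHS]unlock [in RHS]unlock.
rewrite (expectation_law mX mf PX) (expectation_law mX mg PX).
set m := fine _; set m' := fine _.
rewrite -(@expectation_law _ _ X ((f \- cst m) * (g \- cst m'))%R mX _ PX)//.
by apply: (@measurable_funM _ _ _ _ (f \- cst m)%R (g \- cst m')%R);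
  exact: measurable_funB.
Qed.

End Transfer.

(** * Moments of linear combinations of square-integrable variables *)

Section SquareIntegrable.
Context d (T : measurableType d) (R : realType).
Local Open Scope ereal_scope.

Lemma Lfun2P (P : probability T R) (f : T -> R) :
  f \in Lfun P 2%:E <->
  measurable_fun setT f /\ \int[P]_x ((f x ^+ 2)%:E) < +oo.
Proof.
split=> [/[dup] /Lfun2_integrable_sqr /integrableP[_ +] fL|[mf foo]].
  move: fL; rewrite inE => /andP[/[!inE]/= mf _] H; split => //.
  by move: H; under eq_integral => x _ do rewrite /= ger0_norm ?sqr_ge0//.
rewrite inE; apply/andP; split; rewrite inE //= /finite_norm unlock.
rewrite poweR_lty//; apply: le_lt_trans foo.
under eq_integral => x _ do rewrite /= powR_mulrn// -normrX ger0_norm ?sqr_ge0//.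
exact: lexx.
Qed.

Lemma Lfun21 (P : probability T R) (f : T -> R) :
  f \in Lfun P 2%:E -> f \in Lfun P 1.
Proof. by apply: Lfun_subset12; exact: fin_num_measure. Qed.

Lemma Lfun2_lincomb (P : probability T R) (I : Type) (r : seq I) (v : I -> R)
    (U : I -> T -> R) :
  (forall i, U i \in Lfun P 2%:E) ->
  (fun x => \sum_(i <- r) v i * U i x)%R \in Lfun P 2%:E.
Proof.
move=> U2; elim: r => [|i r IH].
  by under eq_fun do rewrite big_nil; exact: Lfun_cst.
under eq_fun do rewrite big_cons.
have -> : (fun x => v i * U i x + \sum_(j <- r) v j * U j x)%R =
    (v i \o* U i \+ (fun x => \sum_(j <- r) v j * U j x))%R.
  by apply/funext => x /=; rewrite mulrC.
by rewrite rpredD ?lee1n//= ?IH ?Lfun_scale ?ler1n.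
Qed.

Lemma expectation_lincomb (P : probability T R) (I : Type) (r : seq I) (v : I -> R)
    (U : I -> T -> R) :
  (forall i, U i \in Lfun P 2%:E) ->
  'E_P[fun x => \sum_(i <- r) v i * U i x]%R = \sum_(i <- r) (v i)%:E * 'E_P[U i].
Proof.
move=> U2; elim: r => [|i r IH].
  by under eq_fun do rewrite big_nil; rewrite big_nil expectation_cst.
under eq_fun do rewrite big_cons.
have -> : (fun x => v i * U i x + \sum_(j <- r) v j * U j x)%R =
    (v i \o* U i \+ (fun x => \sum_(j <- r) v j * U j x))%R.
  by apply/funext => x /=; rewrite mulrC.
rewrite big_cons -IH expectationD; last 2 first.
- by rewrite Lfun_scale// Lfun21.
- by rewrite Lfun21// Lfun2_lincomb.
by rewrite expectationZl// Lfun21.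
Qed.

Lemma covariance_lincombl (P : probability T R) (I : Type) (r : seq I) (v : I -> R)
    (U : I -> T -> R) (Z : T -> R) :
  (forall i, U i \in Lfun P 2%:E) -> Z \in Lfun P 2%:E ->
  covariance P (fun x => \sum_(i <- r) v i * U i x)%R Z =
  \sum_(i <- r) (v i)%:E * covariance P (U i) Z.
Proof.
move=> U2 Z2; elim: r => [|i r IH].
  by under eq_fun do rewrite big_nil; rewrite big_nil covariance_cst_l.
under eq_fun do rewrite big_cons.
have -> : (fun x => v i * U i x + \sum_(j <- r) v j * U j x)%R =
    (v i \o* U i \+ (fun x => \sum_(j <- r) v j * U j x))%R.
  by apply/funext => x /=; rewrite mulrC.
rewrite big_cons -IH covarianceDl ?Lfun_scale ?Lfun2_lincomb ?ler1n//.
by rewrite covarianceZl//; [exact: Lfun21|exact: Lfun21|exact: Lfun2_mul_Lfun1].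
Qed.

Lemma covariance_lincomb (P : probability T R) (I J : Type) (r : seq I) (s : seq J)
    (v : I -> R) (w : J -> R) (U : I -> T -> R) (V : J -> T -> R) :
  (forall i, U i \in Lfun P 2%:E) -> (forall j, V j \in Lfun P 2%:E) ->
  covariance P (fun x => \sum_(i <- r) v i * U i x)%R
               (fun x => \sum_(j <- s) w j * V j x)%R =
  \sum_(i <- r) (v i)%:E * \sum_(j <- s) (w j)%:E * covariance P (U i) (V j).
Proof.
move=> U2 V2; rewrite covariance_lincombl ?Lfun2_lincomb//.
apply: eq_bigr => i _; rewrite covarianceC covariance_lincombl//.
by under eq_bigr do rewrite covarianceC.
Qed.

End SquareIntegrable.

Section Law.
Context d d' (T : measurableType d) (T' : measurableType d') (R : realType).

Definition mfun_of (X : T -> T') (mX : measurable_fun setT X) : {mfun T >-> T'} :=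
  HB.pack X (isMeasurableFun.Build _ _ _ _ _ mX).

Definition law (P : probability T R) (X : T -> T') (mX : measurable_fun setT X) :
  probability T' R := distribution P (mfun_of mX).

End Law.

(** * Independent families are pairwise uncorrelated *)

Section Independence.
Context d d' (Om : measurableType d) (T : measurableType d') (R : realType).
Local Open Scope ereal_scope.

Definition independent_family (P : probability Om R) N (X : 'I_N -> Om -> T) :=
  (forall p, measurable_fun setT (X p)) /\
  forall A : 'I_N -> set T, (forall p, measurable (A p)) ->
    P (\bigcap_(p in [set: 'I_N]) (X p @^-1` A p)) = \prod_(p < N) P (X p @^-1` A p).

Lemma independent_pair (P : probability Om R) N (X : 'I_N -> Om -> T) p q A B :
  independent_family P X -> p != q -> measurable A -> measurable B ->
  P (X p @^-1` A `&` X q @^-1` B) = P (X p @^-1` A) * P (X q @^-1` B).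
Proof.
move=> [_ PX] pq mA mB.
(* The product formula for the whole family reduces to two indices by taking the full space at all
   others. *)
pose C i := if i == p then A else if i == q then B else setT.
have mC i : measurable (C i) by rewrite /C; case: ifP => // _; case: ifP.
have Cp : C p = A by rewrite /C eqxx.
have Cq : C q = B by rewrite /C eqxx eq_sym (negbTE pq).
have := PX C mC.
rewrite (bigD1 p)//= (bigD1 q) 1?eq_sym//= big1 => [|i /andP[ip iq]]; last first.
  by rewrite /C (negbTE ip) (negbTE iq) preimage_setT probability_setT.
rewrite mule1 Cp Cq => <-; congr (P _); apply/seteqP; split=> [w [wA wB] i _|w H].
  by rewrite /C; case: eqP => [->//|_]; case: eqP => [->|].
by split; [have := H p I; rewrite Cp|have := H q I; rewrite Cq].
Qed.

(** The joint law of the two variables is the product of their laws, so Fubini factors the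
    expectation of their product. *)
Lemma independent_covariance (P : probability Om R) N (X : 'I_N -> Om -> T)
    p q (f g : T -> R) :
  independent_family P X -> p != q ->
  measurable_fun setT f -> measurable_fun setT g ->
  (f \o X p)%R \in Lfun P 2%:E -> (g \o X q)%R \in Lfun P 2%:E ->
  covariance P (f \o X p)%R (g \o X q)%R = 0.
Proof.
move=> indX pq mf mg; set U := (f \o X p)%R; set V := (g \o X q)%R => U2 V2.
have [mX _] := indX.
have mU : measurable_fun setT U by exact: measurableT_comp.
have mV : measurable_fun setT V by exact: measurableT_comp.
have mW : measurable_fun setT (fun w => (U w, V w)) by exact: measurable_fun_pair.
(* A measure that agrees with the product measure on rectangles equals it; on rectangles this is
   pairwise independence. *)
have prodW (Z : set (R * R)) : measurable Z ->
    (law P mU \x law P mV) Z = law P mW Z.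
  apply: product_measure_unique => A B mA mB.
  have mfA : measurable (f @^-1` A) by rewrite -[f @^-1` A]setTI; exact: mf.
  have mgB : measurable (g @^-1` B) by rewrite -[g @^-1` B]setTI; exact: mg.
  rewrite [LHS](_ : _ = P (X p @^-1` (f @^-1` A) `&` X q @^-1` (g @^-1` B)))//.
  by rewrite (independent_pair indX).
have mM : measurable_fun setT (fun z : R * R => (z.1 * z.2)%:E).
  by apply/measurable_EFinP; exact: measurable_funM.
have UV1 : (U \* V)%R \in Lfun P 1 by exact: Lfun2_mul_Lfun1.
have EUV : 'E_P[U * V]%R = \int[law P mU \x law P mV]_z (z.1 * z.2)%:E.
  rewrite [LHS](_ : _ = \int[P]_w ((U w, V w).1 * (U w, V w).2)%:E); last by rewrite unlock.
  rewrite (integral_law mW mM (mu := law P mW))//.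
  by apply: eq_measure_integral => A mA _; apply/esym/prodW.
have iM : (law P mU \x law P mV).-integrable setT (fun z : R * R => (z.1 * z.2)%:E).
  apply/integrableP; split => //.
  rewrite (eq_measure_integral (law P mW)) => [|A mA _]; last exact: prodW.
  rewrite -(integral_law (X := fun w => (U w, V w)) (P := P) mW)//; last exact: measurableT_comp.
  by have /Lfun1_integrable/integrableP[] := UV1.
have EU : 'E_P[U] = \int[law P mU]_x x%:E.
  by rewrite unlock -(integral_law (X := U) (P := P) mU).
have EV : 'E_P[V] = \int[law P mV]_x x%:E.
  by rewrite unlock -(integral_law (X := V) (P := P) mV).
rewrite covarianceE; [|exact: Lfun21|exact: Lfun21|exact: UV1].
rewrite EUV -(integral12_prod_meas1 iM) /fubini_F /=.
have iid : (law P mV).-integrable setT (EFin : R -> \bar R).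
  apply/integrableP; split; first exact/measurable_EFinP.
  rewrite -(integral_law (X := V) (P := P) mV)//; last first.
    by apply: measurableT_comp => //; exact/measurable_EFinP.
  by have /Lfun21/Lfun1_integrable/integrableP[] := V2.
under eq_integral => x _.
  under eq_integral do rewrite EFinM.
  rewrite integralZl// -EV -(fineK (expectation_fin_num (Lfun21 V2))).
  over.
rewrite integralZr//; last first.
  apply/integrableP; split; first exact/measurable_EFinP.
  rewrite -(integral_law (X := U) (P := P) mU)//; last first.
    by apply: measurableT_comp => //; exact/measurable_EFinP.
  by have /Lfun21/Lfun1_integrable/integrableP[] := U2.
by rewrite -EU fineK ?expectation_fin_num ?Lfun21// subee// fin_numM ?expectation_fin_num ?Lfun21.
Qed.

End Independence.

(** * Power measures and translated densities *)

Section Power.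
Context d (T : measurableType d) (R : realType).
Local Open Scope ereal_scope.

Definition tcons n (x : T * n.-tuple T) : n.+1.-tuple T := [tuple of x.1 :: x.2].

Lemma measurable_tcons n : measurable_fun setT (@tcons n).
Proof. exact: (@measurable_cons _ _ _ _ fst n snd). Qed.

(** The [n]-fold product measure, carried by tuples. It is used at two levels: the [k] coordinates
    of a Gaussian vector, and the samples of a data set. *)
Fixpoint power_prob (Q : probability T R) n : probability (n.-tuple T) R :=
  match n with
  | 0 => \d_([tuple] : 0.-tuple T)
  | n'.+1 => law (Q \x power_prob Q n') (@measurable_tcons n')
  end.

Variable Q : probability T R.

Lemma integral_pow0 (G : 0.-tuple T -> \bar R) : measurable_fun setT G ->
  \int[power_prob Q 0]_w G w = G [tuple].
Proof. by move=> mG; rewrite integral_dirac// diracT mul1e. Qed.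

Lemma integral_powS n (G : n.+1.-tuple T -> \bar R) :
  measurable_fun setT G -> (forall w, 0 <= G w) ->
  \int[power_prob Q n.+1]_w G w = \int[Q]_x \int[power_prob Q n]_y G [tuple of x :: y].
Proof.
move=> mG G0.
rewrite -(integral_law (P := Q \x power_prob Q n) (X := @tcons n) (@measurable_tcons n))//.
rewrite fubini_tonelli1//.
by apply: measurableT_comp => //; exact: measurable_tcons.
Qed.

Lemma pow_rect n (A : 'I_n -> set T) : (forall i, measurable (A i)) ->
  power_prob Q n [set w | forall i, A i (tnth w i)] = \prod_(i < n) Q (A i).
Proof.
elim: n A => [|n IH] A mA.
  rewrite big_ord0 (_ : [set w | _] = setT) ?probability_setT//.
  by apply/seteqP; split => // w _ [].
rewrite big_ord_recl -IH//.
rewrite -product_measure1E//; last first.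
  rewrite (_ : [set w | _] = \bigcap_(i in [set: 'I_n])
      ((fun w : n.-tuple T => tnth w i) @^-1` A (lift ord0 i))); last first.
    by apply/seteqP; split => [w H i _|w H i]; exact: H.
  apply: fin_bigcap_measurable => // i _.
  by rewrite -[_ @^-1` _]setTI; exact: measurable_tnth.
transitivity ((Q \x power_prob Q n) (@tcons n @^-1` [set w | forall i, A i (tnth w i)])) => //.
congr ((Q \x power_prob Q n) _); apply/seteqP; split=> -[x y] /=.
  move=> H; split; first by have := H ord0.
  by move=> i; have := H (lift ord0 i); rewrite /tcons tnthS.
by move=> [Ax Ay] i; case: (unliftP ord0 i) => [j|] ->; rewrite /tcons ?tnthS.
Qed.

Lemma measurable_prod_tnth n (l : 'I_n -> T -> R) :
  (forall i, measurable_fun setT (l i)) ->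
  measurable_fun setT (fun w : n.-tuple T => \prod_i l i (tnth w i))%R.
Proof.
move=> ml; apply: measurable_prod => i _.
by apply: measurableT_comp => //; exact: measurable_tnth.
Qed.

Definition tmap n (S : 'I_n -> T -> T) (w : n.-tuple T) : n.-tuple T :=
  [tuple S i (tnth w i) | i < n].

Lemma measurable_tmap n (S : 'I_n -> T -> T) :
  (forall i, measurable_fun setT (S i)) -> measurable_fun setT (tmap S).
Proof.
move=> mS; apply/measurable_fun_tnthP => i.
rewrite (_ : _ \o _ = S i \o (fun w => tnth w i)); last first.
  by apply/funext => w; rewrite /= tnth_mktuple.
by apply: measurableT_comp => //; exact: measurable_tnth.
Qed.

End Power.

Section Tilt.
Context (R : realType).
Local Open Scope ereal_scope.

(* The image of [P] under [S] has density [l] with respect to [P]; [e - 1] is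
   the corresponding chi-square divergence. *)
Definition tilt d (T : measurableType d) (P : probability T R) (S : T -> T)
    (l : T -> R) (e : R) : Prop :=
  [/\ measurable_fun setT S, measurable_fun setT l, forall x, (0 <= l x)%R,
      forall G : T -> \bar R, measurable_fun setT G -> (forall x, 0 <= G x) ->
        \int[P]_x G (S x) = \int[P]_x (G x * (l x)%:E) &
      \int[P]_x ((l x ^+ 2)%:E) = e%:E].

(** Densities of independent coordinates multiply, and so do their second moments. Both claims go by
    induction, the first coordinate being separated by Tonelli. *)
Lemma tilt_pow d (T : measurableType d) (Q : probability T R) n
    (S : 'I_n -> T -> T) (l : 'I_n -> T -> R) (e : 'I_n -> R) :
  (forall i, tilt Q (S i) (l i) (e i)) ->
  tilt (power_prob Q n) (tmap S) (fun w => \prod_i l i (tnth w i))%R (\prod_i e i)%R.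
Proof.
move=> Ql.
have mS i : measurable_fun setT (S i) by case: (Ql i).
have ml i : measurable_fun setT (l i) by case: (Ql i).
have l0 i x : (0 <= l i x)%R by case: (Ql i).
have mlp := measurable_prod_tnth ml.
split => //; first exact: measurable_tmap.
- by move=> w; exact: prodr_ge0.
- elim: n S l e Ql mS ml l0 mlp => [|n IH] S l e Ql mS ml l0 mlp G mG G0.
    rewrite integral_pow0; last by apply: measurableT_comp => //; exact: measurable_tmap.
    rewrite integral_pow0; last first.
      by apply: emeasurable_funM => //; exact/measurable_EFinP.
    by rewrite big_ord0 mule1; congr G; exact: tuple0.
  pose S' (i : 'I_n) := S (lift ord0 i); pose l' (i : 'I_n) := l (lift ord0 i).
  have mlp' : measurable_fun setT (fun w : n.-tuple T => \prod_i l' i (tnth w i))%R.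
    by apply: measurable_prod_tnth => i; exact: ml.
  have mGc : measurable_fun setT (fun z : T * n.-tuple T => G [tuple of z.1 :: z.2]).
    by apply: measurableT_comp => //; exact: measurable_tcons.
  have mGx x : measurable_fun setT (fun y : n.-tuple T => G [tuple of x :: y]).
    by apply: measurableT_comp => //; apply: measurable_cons.
  have mGl : measurable_fun setT (fun z : T * n.-tuple T =>
      G [tuple of z.1 :: z.2] * (\prod_i l' i (tnth z.2 i))%:E).
    apply: emeasurable_funM => //; apply/measurable_EFinP.
    exact: (measurableT_comp mlp').
  rewrite integral_powS//; last by apply: measurableT_comp => //; exact: measurable_tmap.
  have E x (y : n.-tuple T) : tmap S [tuple of x :: y] = [tuple of S ord0 x :: tmap S' y].
    apply: eq_from_tnth => i; rewrite tnth_mktuple.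
    by case: (unliftP ord0 i) => [j|] ->; rewrite ?tnthS ?tnth_mktuple.
  (* The inner integral, after the induction hypothesis has moved the translation of the last [n]
     coordinates into a density; what remains is a function of the first coordinate only. *)
  pose H x := \int[power_prob Q n]_y (G [tuple of x :: y] * (\prod_i l' i (tnth y i))%:E).
  have H0 x : 0 <= H x.
    by apply: integral_ge0 => y _; rewrite mule_ge0// lee_fin prodr_ge0// => i _; exact: l0.
  have mH : measurable_fun setT H.
    apply: (measurable_fun_fubini_tonelli_F (m2 := power_prob Q n) (fun z : T * n.-tuple T =>
      G [tuple of z.1 :: z.2] * (\prod_i l' i (tnth z.2 i))%:E)) => //.
    by move=> z; rewrite mule_ge0// lee_fin prodr_ge0// => i _; exact: l0.
  transitivity (\int[Q]_x H (S ord0 x)).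
    apply: eq_integral => x _; under eq_integral do rewrite E.
    rewrite (IH S' l' (fun i => e (lift ord0 i)) (fun i => Ql _) (fun i => mS _)
      (fun i => ml _) (fun i => l0 _) mlp' (fun y : n.-tuple T => G [tuple of S ord0 x :: y]))//.
  have [_ _ _ -> //] := Ql ord0.
  rewrite integral_powS//; last 2 first.
  - by apply: emeasurable_funM => //; exact/measurable_EFinP.
  - by move=> w; rewrite mule_ge0// lee_fin prodr_ge0.
  move=> _; apply: eq_integral => x _; rewrite muleC -ge0_integralZl//; last 3 first.
  - by apply: emeasurable_funM => //; exact/measurable_EFinP.
  - by move=> y _; rewrite mule_ge0// lee_fin prodr_ge0// => i _; exact: l0.
  - by rewrite lee_fin l0.
  apply: eq_integral => y _; rewrite big_ord_recl EFinM muleCA; congr (_ * (_ * _)).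
  by congr EFin; apply: eq_bigr => i _; rewrite tnthS.
- elim: n S l e Ql mS ml l0 mlp => [|n IH] S l e Ql mS ml l0 mlp.
    rewrite integral_pow0; last by apply/measurable_EFinP; exact: measurable_funX.
    by rewrite !big_ord0 expr1n.
  pose S' (i : 'I_n) := S (lift ord0 i); pose l' (i : 'I_n) := l (lift ord0 i).
  have mlp' : measurable_fun setT (fun w : n.-tuple T => \prod_i l' i (tnth w i))%R.
    by apply: measurable_prod_tnth => i; exact: ml.
  rewrite integral_powS; last 2 first.
  - by apply/measurable_EFinP; exact: measurable_funX.
  - by move=> w; rewrite lee_fin sqr_ge0.
  pose C := \int[power_prob Q n]_y ((\prod_i l' i (tnth y i)) ^+ 2)%:E.
  have CE : C = (\prod_i e (lift ord0 i))%:E.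
    exact: (IH S' l' _ (fun i => Ql _) (fun i => mS _) (fun i => ml _) (fun i => l0 _)).
  transitivity (\int[Q]_x ((l ord0 x ^+ 2)%:E * C)).
    apply: eq_integral => x _; rewrite -ge0_integralZl//; last 3 first.
    - by apply/measurable_EFinP; exact: measurable_funX.
    - by move=> y _; rewrite lee_fin sqr_ge0.
    - by rewrite lee_fin sqr_ge0.
    apply: eq_integral => y _; rewrite big_ord_recl -EFinM -exprMn; congr ((_ * _) ^+ 2)%:E.
    by apply: eq_bigr => i _; rewrite tnthS.
  rewrite ge0_integralZr//; last 3 first.
  - by apply/measurable_EFinP; exact: measurable_funX.
  - by move=> x _; rewrite lee_fin sqr_ge0.
  - by apply: integral_ge0 => y _; rewrite lee_fin sqr_ge0.
  by have [_ _ _ _ ->] := Ql ord0; rewrite CE big_ord_recl.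
Qed.

End Tilt.

(** * Change of measure and growth of means *)

Section TiltExpectation.
Context (R : realType) d (T : measurableType d) (P : probability T R).
Variables (S : T -> T) (l : T -> R) (e : R).
Hypothesis tPS : tilt P S l e.
Local Open Scope ereal_scope.

(** Since [l] is nonnegative, the positive and negative parts of [Y l] are those of [Y] times [l],
    which reduces the claim to nonnegative functions. *)
Lemma tilt_expectation (Y : T -> R) : measurable_fun setT Y ->
  'E_P[Y \o S]%R = 'E_P[Y \* l]%R.
Proof.
move=> mY; have [mS ml l0 Sl _] := tPS.
have mYE : measurable_fun setT (EFin \o Y) by exact/measurable_EFinP.
rewrite unlock integralE [RHS]integralE; congr (_ - _).
  have := Sl _ (measurable_funepos mYE) (funepos_ge0 _).
  rewrite (eq_integral (fun x => (EFin \o Y)^\+ (S x))) => [->|x _]; last by rewrite !funeposE.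
  apply: eq_integral => x _; rewrite !funeposE /= -EFin_max -EFinM.
  by rewrite -EFin_max maxr_pMl// mul0r.
have := Sl _ (measurable_funeneg mYE) (funeneg_ge0 _).
rewrite (eq_integral (fun x => (EFin \o Y)^\- (S x))) => [->|x _]; last by rewrite !funenegE.
apply: eq_integral => x _; rewrite !funenegE /= -?EFinN -EFin_max -EFinM.
by rewrite -EFin_max maxr_pMl// mul0r mulNr.
Qed.

Lemma tilt_mean : 'E_P[l] = 1.
Proof.
have [mS ml l0 Sl _] := tPS.
have := Sl (cst 1) (measurable_cst _) (fun=> lee01).
under [in X in _ = X]eq_integral do rewrite mul1e.
by rewrite unlock => <-; rewrite integral_cst//= mul1e probability_setT.
Qed.

Lemma tilt_Lfun2 : l \in Lfun P 2%:E.
Proof. by have [mS ml l0 Sl le] := tPS; apply/Lfun2P; rewrite le ltry. Qed.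

Lemma tilt_variance : 'V_P[l] = (e - 1)%:E.
Proof.
rewrite varianceE ?tilt_Lfun2// tilt_mean expe2 mul1e.
by have [_ _ _ _ le] := tPS; rewrite EFinB -le unlock.
Qed.

(** As [l] has mean 1, the increment of the mean is the covariance of [Y] and [l]; Cauchy-Schwarz
    bounds it by the variance of [Y] and the chi-square divergence [e - 1]. *)
Lemma tilt_increment (Y : T -> R) K : Y \in Lfun P 2%:E -> (Y \o S)%R \in Lfun P 2%:E ->
  'V_P[Y] <= K%:E ->
  (fine 'E_P[Y \o S] - fine 'E_P[Y] <= Num.sqrt (K * (e - 1)))%R.
Proof.
move=> Y2 YS2 VY.
have [mS ml l0 _ _] := tPS.
have mY : measurable_fun setT Y by have /Lfun2P[] := Y2.
have l2 := tilt_Lfun2.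
have Yl1 : (Y \* l)%R \in Lfun P 1 by exact: Lfun2_mul_Lfun1.
have covE : covariance P Y l = (fine 'E_P[Y \o S] - fine 'E_P[Y])%R%:E.
  rewrite covarianceE; [|exact: Lfun21|exact: Lfun21|exact: Yl1].
  rewrite EFinB !fineK ?expectation_fin_num ?Lfun21//.
  by rewrite tilt_mean mule1 tilt_expectation.
rewrite -lee_fin -covE; apply: le_trans (covariance_le Y2 l2) _.
rewrite tilt_variance.
have V0 := variance_ge0 P Y.
rewrite -(fineK (variance_fin_num Y2)) in VY V0 *.
rewrite /= -EFinM lee_fin; move: VY V0; rewrite !lee_fin => VY V0.
rewrite sqrtrM ?(le_trans V0)//.
by rewrite ler_wpM2r ?sqrtr_ge0// ler_wsqrtr.
Qed.

End TiltExpectation.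

(** * A Hammersley-Chapman-Robbins bound for biased estimators *)

Section HCR.
Variable R : realType.

Lemma multiple_le (x y : R) : (forall n : nat, n%:R * x <= y) -> x <= 0.
Proof.
move=> xy; rewrite leNgt; apply/negP => x0.
have := xy (Num.bound (y / x)); rewrite leNgt => /negP; apply.
rewrite -ltr_pdivrMr//; apply: archi_boundP.
by have := xy 0; rewrite mul0r => y0; rewrite divr_ge0// ltW.
Qed.

(** The limit [x -> 0] of the hypothesis divided by [x], taken without limits: [e^y - 1 <= y e^y]
    turns it into [b <= K s e^(s x)], which a small [x] contradicts when [b > K s]. *)
Lemma expR_secant_limit (b K s : R) : 0 <= s -> 0 <= K ->
  (forall x, 0 < x -> b * x <= K * (expR (s * x) - 1)) -> b <= K * s.
Proof.
move=> s0 K0 H; rewrite leNgt; apply/negP => Ksb.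
have Ks0 : 0 <= K * s by exact: mulr_ge0.
have {}H x : 0 < x -> b <= K * s * expR (s * x).
  move=> x0; rewrite -(ler_pM2r x0); apply: le_trans (H x x0) _.
  have : 1 - s * x <= expR (- (s * x)) by apply: le_trans (expR_ge1Dx _); lra.
  rewrite expRN -(ler_pM2r (expR_gt0 (s * x))) mulVf ?gt_eqF ?expR_gt0// => h.
  have {}h : expR (s * x) - 1 <= s * x * expR (s * x) by lra.
  by apply: le_trans (ler_wpM2l K0 h) _; rewrite !mulrA; lra.
have [Ks|Ks] := eqVneq (K * s) 0.
  by have := H 1 ltr01; rewrite Ks mul0r => b0; rewrite Ks ltNge b0 in Ksb.
have Ksp : 0 < K * s by rewrite lt_def Ks.
have sp : 0 < s by rewrite lt_def s0 andbT; apply: contra Ks => /eqP ->; rewrite mulr0.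
have bp : 0 < b by exact: lt_trans Ksb.
pose q := b / (K * s); have q1 : 1 < q by rewrite ltr_pdivlMr// mul1r.
have lnq : 0 < ln q by rewrite ln_gt0.
(* At this point [e^(s x)] is the square root of [q], so the bound would read [q <= sqrt q] although
   [q > 1]. *)
have := H (ln q / s / 2); rewrite !divr_gt0// => /(_ isT).
rewrite leNgt => /negP; apply.
have -> : s * (ln q / s / 2) = ln q / 2 by field; rewrite gt_eqF.
rewrite mulrC -ltr_pdivlMr// -/q -[ltRHS]lnK; last by rewrite posrE (lt_trans ltr01).
by rewrite ltr_expR; lra.
Qed.

Context d (T : measurableType d) (P : probability T R).
Variables (S : R -> T -> T) (l : R -> T -> R) (G : R -> T -> R) (s b K : R).
Hypothesis s0 : 0 <= s.
Hypothesis SP : forall t, tilt P (S t) (l t) (expR (s * t ^+ 2)).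
Hypothesis mG : forall t, measurable_fun setT (G t).
Hypothesis GS : forall t u w, G (t + u) w = G t (S u w).
Hypothesis risk : forall t, (\int[P]_w ((G t w - t * b) ^+ 2)%:E <= K%:E)%E.

Let Y t := (G t \- cst (t * b)).

Let Y2 t : Y t \in Lfun P 2%:E.
Proof.
apply/Lfun2P; split; first exact: measurable_funB.
by apply: le_lt_trans (risk t) _; rewrite ltry.
Qed.

Let G2 t : G t \in Lfun P 2%:E.
Proof.
have -> : G t = (Y t \+ cst (t * b)) by apply/funext => w; rewrite /Y /= subrK.
by rewrite rpredD ?lee1n//= ?Y2 ?Lfun_cst.
Qed.

Let K0 : 0 <= K.
Proof.
rewrite -lee_fin; apply: le_trans (risk 0).
by apply: integral_ge0 => w _; rewrite lee_fin sqr_ge0.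
Qed.

Let m t := fine 'E_P[G t]%E.

Let EY t : 'E_P[Y t]%E = (m t - t * b)%:E.
Proof.
rewrite expectationB ?Lfun21 ?Lfun_cst// expectation_cst EFinB /m fineK//.
by rewrite expectation_fin_num// Lfun21.
Qed.

Let VY t : ('V_P[Y t] = \int[P]_w ((G t w - t * b) ^+ 2)%:E - ((m t - t * b) ^+ 2)%:E)%E.
Proof. by rewrite varianceE// EY unlock EFin_expe. Qed.

(** The variance is at most the second moment about any constant, here [t b]. *)
Let VG t : ('V_P[G t] <= K%:E)%E.
Proof.
have -> : ('V_P[G t] = 'V_P[Y t])%E by rewrite varianceB_cst_r.
rewrite VY; apply: le_trans (risk t); rewrite leeBlDr// leeDl// lee_fin sqr_ge0//.
Qed.

Let bias t : `|m t - t * b| <= Num.sqrt K.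
Proof.
rewrite -sqrtr_sqr ler_wsqrtr// -lee_fin; apply: le_trans (risk t).
by have := variance_ge0 P (Y t); rewrite VY sube_ge0.
Qed.

Let incr t u : m (t + u) - m t <= Num.sqrt (K * (expR (s * u ^+ 2) - 1)).
Proof.
have GE : G (t + u) = G t \o S u by apply/funext => w; exact: GS.
have := tilt_increment (SP u) (G2 t) _ (VG t).
by rewrite -GE; apply; exact: G2.
Qed.

(** Summing [n] increments from 0 to [n u] gives [n b u <= n q + 2 sqrt K], the last term accounting
    for the bias at both ends. Its size does not depend on [n], so the Archimedean property removes
    it. *)
Let step u : b * u <= Num.sqrt (K * (expR (s * u ^+ 2) - 1)).
Proof.
set q := Num.sqrt _; rewrite -subr_le0; apply: (@multiple_le _ (2 * Num.sqrt K)) => n.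
have mn : m (n%:R * u) - m 0 <= n%:R * q.
  elim: n => [|n IH]; first by rewrite !mul0r subrr.
  have := incr (n%:R * u) u; rewrite -/q -[in n.+1]addn1 natrD !mulrDl !mul1r; lra.
have := bias (n%:R * u); have := bias 0.
by rewrite !ler_norml mul0r => /andP[? ?] /andP[? ?]; nra.
Qed.

(** Here [G t] is the estimator at parameter [t], as a function of the noise. Squaring the one-step
    bound and setting [x = u^2] leaves an inequality to which the secant limit applies. *)
Lemma hcr_bound : b ^+ 2 <= K * s.
Proof.
apply: expR_secant_limit => // x x0.
(* The sign of [u] makes [b u] nonnegative, so that squaring preserves the inequality. *)
pose u := if 0 <= b then Num.sqrt x else - Num.sqrt x.
have u2 : u ^+ 2 = x by rewrite /u; case: ifP => _; rewrite ?sqrrN sqr_sqrtr ?ltW.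
have bu : 0 <= b * u.
  rewrite /u; case: ifPn => b0; first by rewrite mulr_ge0 ?sqrtr_ge0.
  by rewrite mulrN -mulNr mulr_ge0 ?sqrtr_ge0// oppr_ge0 ltW// ltNge.
have q0 : 0 <= K * (expR (s * x) - 1).
  rewrite mulr_ge0// subr_ge0 -expR0 ler_expR mulr_ge0// ltW//.
have := step u; rewrite u2 => bq.
rewrite -{1}u2 -exprMn -[leRHS]sqr_sqrtr//.
by rewrite ler_pXn2r// nnegrE ?sqrtr_ge0.
Qed.

End HCR.

(** * The standard Gaussian *)

Section Gaussian.
Variable R : realType.

(* [R] and [measurableTypeR R] carry the same sigma-algebra under different
   displays, and [normal_prob] is a probability on the latter only. *)
Lemma measurable_id_TypeR : measurable_fun setT (idfun : measurableTypeR R -> R).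
Proof. by move=> _ A mA; rewrite setTI. Qed.

Definition gauss : probability R R :=
  law (normal_prob (0 : R) 1 : probability (measurableTypeR R) R) measurable_id_TypeR.

Local Notation leb := (@lebesgue_measure R).
Local Notation phi := (normal_pdf (0 : R) 1).

(** The Radon-Nikodym derivative of the normal law and its density [phi] have the same integral over
    every measurable set, hence agree almost everywhere. *)
Lemma ge0_integral_gauss (G : R -> \bar R) : measurable_fun setT G ->
  (forall x, (0 <= G x)%E) ->
  (\int[gauss]_x G x = \int[leb]_x (G x * (phi x)%:E))%E.
Proof.
move=> mG G0; have dom := @normal_prob_dominates R 0 1.
rewrite -(integral_law measurable_id_TypeR mG (P := normal_prob 0 1))//.
rewrite -(Radon_Nikodym_SigmaFinite.change_of_variables dom G0 measurableT mG).
have mf := measurable_int _ (Radon_Nikodym_SigmaFinite.f_integrable dom).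
have mphi : measurable_fun setT (EFin \o phi).
  by apply/measurable_EFinP; exact: measurable_normal_pdf.
apply: ge0_ae_eq_integral => //.
- exact: emeasurable_funM.
- exact: emeasurable_funM.
- by move=> x _; rewrite mule_ge0// Radon_Nikodym_SigmaFinite.f_ge0.
- by move=> x _; rewrite mule_ge0// lee_fin normal_pdf_ge0.
apply: ae_eqe_mul2l; apply: integral_ae_eq => //.
  exact: Radon_Nikodym_SigmaFinite.f_integrable.
by move=> E _ mE; rewrite -Radon_Nikodym_SigmaFinite.f_integral.
Qed.

(** By uniqueness of Lebesgue measure, comparison on half-open intervals suffices. *)
Lemma lebesgue_measureD (u : R) (A : set R) : measurable A ->
  pushforward leb ((fun x => x + u) : _ -> measurableTypeR R) A = leb A.
Proof.
have mu : measurable_fun setT (fun x : R => x + u) by exact: measurable_funD.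
move=> mA.
pose nu : {measure set (measurableTypeR R) -> \bar R} :=
  measure_function_pushforward__canonical__measure_function_Measure leb
    (mu : measurable_fun setT ((fun x : R => x + u) : measurableTypeR R -> measurableTypeR R)).
apply/esym; apply: (lebesgue_measure_unique (mu := nu)) => //.
move=> _ [[a b]] _ <- /=.
transitivity (leb `]a - u, b - u]%classic); last first.
  congr (leb _); apply/seteqP.
  by split => x; rewrite /= !in_itv /= ltrBlDr lerBrDr.
rewrite !lebesgue_measure_itv /= !lte_fin ltrD2r; case: ifP => // _.
by rewrite -!EFinB; congr EFin; ring.
Qed.

Lemma ge0_integral_lebesgueD (u : R) (G : R -> \bar R) : measurable_fun setT G ->
  (forall x, (0 <= G x)%E) -> (\int[leb]_x G (x + u)%R = \int[leb]_x G x)%E.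
Proof.
move=> mG G0; have mu : measurable_fun setT (fun x : R => x + u) by exact: measurable_funD.
have := @ge0_integral_pushforward _ _ (measurableTypeR R) (measurableTypeR R) R _
  mu leb setT G measurableT mG (fun x _ => G0 x).
rewrite preimage_setT => <-.
by apply: eq_measure_integral => A mA _; exact: lebesgue_measureD.
Qed.

(** The likelihood ratio of [N(u, 1)] to [N(0, 1)]. *)
Definition gauss_ratio (u x : R) := expR (u * x - u ^+ 2 / 2).

Lemma measurable_gauss_ratio u : measurable_fun setT (gauss_ratio u).
Proof.
apply: measurableT_comp => //; apply: measurable_funB => //.
Qed.

Lemma normal_pdf_shift u x : phi (x - u) = gauss_ratio u x * phi x.
Proof.
rewrite !normal_pdfE ?oner_eq0// mulrCA; congr (_ * _).
rewrite /normal_fun /gauss_ratio -expRD; congr expR.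
by rewrite !subr0 expr1n; field.
Qed.

Lemma gauss_shift u (G : R -> \bar R) : measurable_fun setT G ->
  (forall x, (0 <= G x)%E) ->
  (\int[gauss]_x G (x + u)%R = \int[gauss]_x (G x * (gauss_ratio u x)%:E))%E.
Proof.
move=> mG G0; have mu : measurable_fun setT (fun x : R => x + u) by exact: measurable_funD.
have ml := measurable_gauss_ratio u.
have mphi : measurable_fun setT phi by exact: measurable_normal_pdf.
rewrite ge0_integral_gauss//; last exact: measurableT_comp.
rewrite ge0_integral_gauss; last 2 first.
- by apply: emeasurable_funM => //; exact/measurable_EFinP.
- by move=> x; rewrite mule_ge0// lee_fin expR_ge0.
rewrite -[RHS](ge0_integral_lebesgueD u); last 2 first.
- by do 2?apply: emeasurable_funM => //; exact/measurable_EFinP.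
- by move=> x; rewrite !mule_ge0// lee_fin ?expR_ge0 ?normal_pdf_ge0.
apply: eq_integral => x _; rewrite -muleA -EFinM -normal_pdf_shift addrK//.
Qed.

(** The square of the ratio at [u] is [e^(u^2)] times the ratio at [2 u], and the latter integrates
    to 1. *)
Lemma gauss_tilt u : tilt gauss (fun x => x + u) (gauss_ratio u) (expR (u ^+ 2)).
Proof.
split; [exact: measurable_funD|exact: measurable_gauss_ratio| | exact: gauss_shift |].
  by move=> x; exact: expR_ge0.
under eq_integral => x _.
  have -> : gauss_ratio u x ^+ 2 = expR (u ^+ 2) * gauss_ratio (u + u) x.
    by rewrite /gauss_ratio expr2 -!expRD; congr expR; field.
  rewrite EFinM; over.
rewrite ge0_integralZl//; last 2 first.
- by apply/measurable_EFinP; exact: measurable_gauss_ratio.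
- by move=> x _; rewrite lee_fin expR_ge0.
have := @gauss_shift (u + u) (cst 1%E) (measurable_cst _) (fun=> lee01).
under [in X in _ = X]eq_integral do rewrite mul1e.
by move=> <-; rewrite integral_cst//= mul1e probability_setT mule1.
Qed.

(** The difference [e^x + e^(-x) - 2] is the square of [e^(x/2) - e^(-x/2)], which is at least [x]
    for [x >= 0] by the mean value theorem, its integrand-free form being [2 y <= e^y - e^(-y)] at
    [y = x/2]. *)
Lemma sqr_le_expR (x : R) : x ^+ 2 + 2 <= expR x + expR (- x).
Proof.
suff H (y : R) : 0 <= y -> 2 * y <= expR y - expR (- y).
  wlog x0 : x / 0 <= x.
    move=> W; have [/W//|x0] := leP 0 x.
    have := W (- x); rewrite opprK sqrrN oppr_ge0 (ltW x0) => /(_ isT); lra.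
  have := H (x / 2); rewrite divr_ge0// => /(_ isT) h.
  have x2 : expR (x / 2) * expR (- (x / 2)) = 1 by rewrite -expRD subrr expR0.
  have -> : expR x = expR (x / 2) ^+ 2 by rewrite expr2 -expRD -splitr.
  have -> : expR (- x) = expR (- (x / 2)) ^+ 2.
    by rewrite expr2 -expRD; congr expR; lra.
  nra.
rewrite le_eqVlt => /predU1P[<-|y0]; first by rewrite mulr0 oppr0 subrr.
have dF (z : R) : is_derive z (1 : R) (fun z : R => expR z - expR (- z)) (expR z + expR (- z)).
  by apply: is_derive_eq; rewrite mulrN1 opprK.
have cF : {within `[0, y], continuous (fun z : R => expR z - expR (- z))}.
  by apply: derivable_within_continuous => z _; have [] := dF z.
have [c _] := MVT_segment (ltW y0) (fun z _ => dF z) cF.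
rewrite oppr0 expR0 subrr subr0 addr0 => ->; rewrite ler_pM2r//.
by have := expR_ge1Dx c; have := expR_ge1Dx (- c); lra.
Qed.

Lemma integral_gauss_expR u :
  (\int[gauss]_x ((expR (u * x))%:E) = (expR (u ^+ 2 / 2))%:E)%E.
Proof.
have := tilt_mean (gauss_tilt u); rewrite unlock => E1.
rewrite -[RHS]mule1 -[in RHS]E1 -ge0_integralZl//; last 2 first.
- by apply/measurable_EFinP; exact: measurable_gauss_ratio.
- by move=> x _; rewrite lee_fin expR_ge0.
apply: eq_integral => x _; rewrite -EFinM -expRD; congr (expR _)%:E; ring.
Qed.

(** Integrating [sqr_le_expR] at [u x] gives [u^2 v + 2 <= 2 e^(u^2/2)]. The case [u = 1] shows that
    [v] is finite, and [u -> 0] gives [v <= 1]. *)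
Lemma gauss_sqr_le1 : (\int[gauss]_x ((x ^+ 2)%:E) <= 1)%E.
Proof.
set v := (\int[gauss]_x _)%E.
have mX : measurable_fun setT (fun x : R => (x ^+ 2)%:E).
  by apply/measurable_EFinP; exact: measurable_funX.
have mE u : measurable_fun setT (fun x : R => (expR (u * x))%:E).
  by apply/measurable_EFinP; apply: measurableT_comp => //; exact: measurable_funM.
have v0 : (0 <= v)%E by apply: integral_ge0 => x _; rewrite lee_fin sqr_ge0.
have H u : ((u ^+ 2)%:E * v + 2%:E <= (2 * expR (u ^+ 2 / 2))%:E)%E.
  have -> : ((u ^+ 2)%:E * v + 2%:E = \int[gauss]_x ((u ^+ 2 * x ^+ 2 + 2)%:E))%E.
    under eq_integral do rewrite EFinD EFinM.
    rewrite ge0_integralD//; last 2 first.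
    - by move=> x _; rewrite -EFinM lee_fin mulr_ge0 ?sqr_ge0.
    - by apply: emeasurable_funM.
    rewrite ge0_integralZl ?lee_fin ?sqr_ge0//; last first.
      by move=> x _; rewrite lee_fin sqr_ge0.
    by have := expectation_cst gauss 2; rewrite unlock => ->.
  have -> : ((2 * expR (u ^+ 2 / 2))%:E =
      \int[gauss]_x ((expR (u * x) + expR (- u * x))%:E))%E.
    under eq_integral do rewrite EFinD.
    rewrite ge0_integralD//; [|by move=> x _; rewrite lee_fin expR_ge0..].
    by rewrite !integral_gauss_expR sqrrN -EFinD; congr EFin; ring.
  apply: ge0_le_integral => //.
  - by move=> x _; rewrite lee_fin addr_ge0// mulr_ge0 ?sqr_ge0.
  - apply/measurable_EFinP; apply: measurable_funD => //; apply: measurable_funM => //.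
  - by apply/measurable_EFinP; apply: measurable_funD; apply/measurable_EFinP; exact: mE.
  - by move=> x _; rewrite lee_fin -exprMn mulNr sqr_le_expR.
have vfin : v \is a fin_num.
  rewrite ge0_fin_numE//; have := H 1; rewrite expr1n mul1e => h.
  apply: le_lt_trans (ltry (2 * expR (1 / 2))); apply: le_trans h.
  by rewrite leeDl.
have vE : v = (fine v)%:E by rewrite fineK.
move: (fine v) vE => V vE; rewrite vE lee_fin.
have {}H u : u ^+ 2 * V + 2 <= 2 * expR (u ^+ 2 / 2).
  by have := H u; rewrite vE -EFinM -EFinD lee_fin.
(* The bound 1 is written as [K s] with [K = 2] and [s = 1/2], the variable of the secant limit
   being [u^2]. *)
rewrite -[leRHS](_ : 2 * 2^-1 = 1); last by rewrite mulfV.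
apply: expR_secant_limit => // x x0.
have := H (Num.sqrt x); rewrite (sqr_sqrtr (ltW x0)) (mulrC 2^-1 x); lra.
Qed.

(* The second moment is at most 1 by comparison with the moment generating
   function, and the variance is at least 1 by [hcr_bound] for the translates. *)
Lemma gauss_moments : [/\ (fun x : R => x) \in Lfun gauss 2%:E,
  ('E_gauss[fun x : R => x] = 0)%E & ('V_gauss[fun x : R => x] = 1)%E].
Proof.
have X2 : (fun x : R => x) \in Lfun gauss 2%:E.
  by apply/Lfun2P; split; [exact: measurable_id|exact: le_lt_trans gauss_sqr_le1 (ltry 1)].
have Efin := expectation_fin_num (Lfun21 X2).
have Vfin := variance_fin_num X2.
set c := fine ('E_gauss[fun x : R => x])%E.
have Ec : ('E_gauss[fun x : R => x])%E = c%:E by rewrite /c fineK.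
set V := fine ('V_gauss[fun x : R => x])%E.
have EV : ('V_gauss[fun x : R => x])%E = V%:E by rewrite /V fineK.
have V1 : V <= 1 - c ^+ 2.
  rewrite -lee_fin -EV varianceE// Ec -EFin_expe EFinB leeB//.
  by apply: le_trans gauss_sqr_le1; rewrite unlock.
have VE : V%:E = (\int[gauss]_x ((x - c) ^+ 2)%:E)%E.
  by rewrite -EV /variance unlock -/c unlock.
have : 1 ^+ 2 <= V * 1.
  apply: (@hcr_bound R _ _ gauss (fun u x => x + u) gauss_ratio (fun t x => x + t - c)) => //.
  - by move=> t; rewrite mul1r; exact: gauss_tilt.
  - by move=> t; apply: measurable_funB => //; exact: measurable_funD.
  - by move=> t u w; congr (_ - _); rewrite addrA addrAC.
  move=> t; rewrite VE; under eq_integral do rewrite mulr1 addrAC addrK.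
  exact: lexx.
rewrite expr1n mulr1 => V1'.
(* The bounds [1 <= V] and [V <= 1 - c^2] force the mean to vanish as well. *)
have c0 : c = 0 by apply/eqP; rewrite -sqrf_eq0; have := sqr_ge0 c; lra.
split => //; first by rewrite Ec c0.
by rewrite EV; congr EFin; have := sqr_ge0 c; lra.
Qed.

End Gaussian.

(** * Variance of the linear estimators *)

Section Pattern.
Variables (k : nat) (coll : {set {set 'I_k}}) (n : {set 'I_k} -> nat).

Lemma sum_patI (V : zmodType) (F : {set 'I_k} -> V) :
  \sum_(p < ndata coll n) F (patI p) = \sum_(I in coll) F I *+ n I.
Proof.
rewrite -(big_tnth _ _ _ xpredT F) big_flatten big_map big_enum /=.
by apply: eq_bigr => I _; rewrite big_nseq iter_addr_0.
Qed.

End Pattern.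

Section Upper.
Variables (R : realType) (k : nat) (S : 'M[R]_k) (a : 'cV[R]_k).
Variables (coll : {set {set 'I_k}}) (n : {set 'I_k} -> nat) (lam : weights R k).
Hypothesis U : unbiasedU coll a n lam.
Context d (Om : measurableType d) (P : probability Om R).
Variables (mu : probability (k.-tuple R) R) (X : 'I_(ndata coll n) -> Om -> k.-tuple R).
Hypothesis muS : in_PSigma S mu.
Hypothesis iidX : iid_copies P mu X.

Let est w := mppi_est (n := n) lam (obs X w).

(** The zero-padded coefficient vector of a single sample observed on [I]. *)
Let wt (I : {set 'I_k}) : 'cV[R]_k := (n I)%:R^-1 *: ((projI R I)^T *m lam I).

Let crd (i : 'I_k) : k.-tuple R -> R := fun x => tnth x i.
Let Z (x : 'I_(ndata coll n) * 'I_k) : Om -> R := crd x.2 \o X x.1.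
Let v (x : 'I_(ndata coll n) * 'I_k) : R := wt (patI x.1) x.2 0.

Let mcrd i : measurable_fun setT (crd i). Proof. exact: measurable_tnth. Qed.

(** The coefficients vanish outside the observed set, so the masked observations may be replaced by
    the full vectors. Indexing by pairs of a sample and a coordinate gives one flat linear
    combination. *)
Let estE : est = fun w => \sum_x v x * Z x w.
Proof.
apply/funext => w; rewrite /est /mppi_est -(pair_bigA _ (fun p i => v (p, i) * Z (p, i) w)) /=.
apply: eq_bigr => p _; rewrite tnth_mktuple /v /Z /wt /crd /=.
have -> : (lam (patI p))^T *m projI R (patI p) = ((projI R (patI p))^T *m lam (patI p))^T.
  by rewrite trmx_mul trmxK.
have := @projI_trE R k (patI p) (lam (patI p)); move: (_ *m lam _) => Q Q0.
rewrite mxE mulr_sumr; apply: eq_bigr => i _.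
rewrite !mxE tnth_mktuple mulrA; case: ifPn => // iI.
by rewrite Q0// !mulr0 mul0r.
Qed.

Let Z2 x : Z x \in Lfun P 2%:E.
Proof.
have [mX PX _] := iidX; have [muL _] := muS.
have /Lfun2P[_ mu2] := muL x.2; apply/Lfun2P; split; first exact: measurableT_comp.
rewrite (integral_law (mX x.1) (f := fun y => (crd x.2 y ^+ 2)%:E) _ (PX x.1))//.
by apply/measurable_EFinP; exact: measurable_funX.
Qed.

Let covZ x y : covariance P (Z x) (Z y) = (if x.1 == y.1 then (S x.2 y.2)%:E else 0)%E.
Proof.
have [mX PX indX] := iidX; have [muL muC] := muS.
have [xy|xy] := eqVneq x.1 y.1.
  by rewrite /Z -xy (covariance_law (mX x.1) (mcrd x.2) (mcrd y.2) (PX x.1)) muC.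
by apply: (@independent_covariance _ _ _ _ _ P _ X) => //; exact: Z2.
Qed.

Let wt_quad I : (0 < n I)%N -> ((wt I)^T *m S *m wt I) 0 0 *+ n I =
  (n I)%:R^-1 * ((lam I)^T *m SigI S I *m lam I) 0 0.
Proof.
move=> nI; rewrite /wt [(_ *: _)^T]linearZ /= -!scalemxAl -scalemxAr scalerA mxE.
rewrite trmx_mul trmxK /SigI !mulmxA -mulr_natr mulrAC -mulrA.
by rewrite mulrA mulfVK ?pnatr_eq0 -?lt0n.
Qed.

(** Distinct samples are uncorrelated and each has covariance [S]. The [n_I] equal contributions,
    each with a factor [n_I^-2], add up to one factor [n_I^-1]. *)
Lemma mppi_est_variance : ('V_P[est])%E = (mppi_obj coll S n lam)%:E.
Proof.
rewrite estE /variance covariance_lincomb//.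
under eq_bigr => x _.
  under eq_bigr => y _.
    rewrite covZ (_ : (if _ then _ else _)%E = (if x.1 == y.1 then S x.2 y.2 else 0)%:E);
      last by case: ifP.
    rewrite -EFinM; over.
  rewrite sumEFin -EFinM; over.
rewrite sumEFin; congr EFin.
transitivity (\sum_(p < ndata coll n) ((wt (patI p))^T *m S *m wt (patI p)) 0 0).
  rewrite -(pair_bigA _ (fun p i => v (p, i) * \sum_y v y *
    (if p == y.1 then S i y.2 else 0))) /=.
  apply: eq_bigr => p _; rewrite -mulmxA mxE; apply: eq_bigr => i _.
  rewrite mxE /v /=; congr (_ * _).
  rewrite -(pair_bigA _ (fun q j => wt (patI q) j 0 * (if p == q then S i j else 0))) /=.
  rewrite (bigD1 p)//= [X in _ + X]big1 ?addr0 => [|q qp]; last first.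
    by apply: big1 => j _; rewrite eq_sym (negbTE qp) mulr0.
  by rewrite mxE; apply: eq_bigr => j _; rewrite eqxx mulrC.
rewrite (sum_patI coll n (fun I => ((wt I)^T *m S *m wt I) 0 0)) /mppi_obj big_mkcondr /=.
apply: eq_bigr => I _; case: (posnP (n I)) => [->|nI]; first by rewrite mulr0n.
exact: wt_quad.
Qed.

Let sum_wt : \sum_(p < ndata coll n) wt (patI p) = a.
Proof.
rewrite sum_patI -U [RHS]big_mkcondr /=; apply: eq_bigr => I _.
case: (posnP (n I)) => [->|nI]; first by rewrite mulr0n.
by rewrite /wt -scaler_nat scalerA mulfV ?scale1r// pnatr_eq0 -lt0n.
Qed.

Let meanE : ('E_P[est])%E = (theta a mu)%:E.
Proof.
have [mX PX _] := iidX; have [muL _] := muS.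
rewrite estE expectation_lincomb//.
under eq_bigr => x _.
  rewrite (expectation_law (mX x.1) (mcrd x.2) (PX x.1)).
  rewrite -(fineK (expectation_fin_num (Lfun21 (muL x.2)))) -EFinM; over.
rewrite sumEFin /theta; congr EFin.
rewrite -(pair_bigA _ (fun p i => v (p, i) * fine ('E_mu[crd i])%E)) /=.
rewrite exchange_big /=; apply: eq_bigr => i _.
by rewrite -mulr_suml -[in RHS]sum_wt summxE.
Qed.

Lemma mppi_est_mse :
  (\int[P]_w ((est w - theta a mu) ^+ 2)%:E)%E = (mppi_obj coll S n lam)%:E.
Proof. by rewrite -mppi_est_variance /variance unlock meanE unlock. Qed.

End Upper.

(** * The Gaussian shift model *)

Section PowerCoordinates.
Context d (T : measurableType d) (R : realType) (Q : probability T R) (n : nat).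
Local Open Scope ereal_scope.

Lemma pow_coord (i : 'I_n) (C : set T) : measurable C ->
  power_prob Q n ((fun w => tnth w i) @^-1` C) = Q C.
Proof.
move=> mC; pose A j : set T := if j == i then C else setT.
have -> : (fun w : n.-tuple T => tnth w i) @^-1` C = [set w | forall j, A j (tnth w j)].
  apply/seteqP; split => w /= H; last by have := H i; rewrite /A eqxx.
  by move=> j; rewrite /A; case: eqP => [->|].
rewrite pow_rect; last by move=> j; rewrite /A; case: ifP.
rewrite (bigD1 i)//= {1}/A eqxx big1 ?mule1// => j /negbTE ji.
by rewrite /A ji probability_setT.
Qed.

Lemma pow_independent d' (T' : measurableType d') (g : T -> T') :
  measurable_fun setT g ->
  independent_family (power_prob Q n) (fun i w => g (tnth w i)).
Proof.
move=> mg; have mgp A : measurable A -> measurable (g @^-1` A).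
  by move=> mA; rewrite -[_ @^-1` _]setTI; exact: mg.
split=> [i|A mA]; first by apply: measurableT_comp => //; exact: measurable_tnth.
pose B i := g @^-1` A i.
have -> : \bigcap_(i in [set: 'I_n]) ((fun w : n.-tuple T => g (tnth w i)) @^-1` A i) =
    [set w | forall i, B i (tnth w i)].
  by apply/seteqP; split => w H i; [exact: H|move=> _; exact: H].
rewrite pow_rect => [|i]; last exact: mgp.
by apply: eq_bigr => i _; rewrite -(@pow_coord i)//; exact: mgp.
Qed.

End PowerCoordinates.

Section Model.
Variables (R : realType) (k : nat) (S : 'M[R]_k) (L : 'M[R]_k).
Hypothesis LS : L *m L^T = S.
Variable h : 'cV[R]_k.

Let gk := power_prob (gauss R) k.

Let crd (i : 'I_k) : k.-tuple R -> R := fun x => tnth x i.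

Let mcrd i : measurable_fun setT (crd i). Proof. exact: measurable_tnth. Qed.

Let crd_law i (C : set R) : measurable C -> gk (crd i @^-1` C) = gauss R C.
Proof. exact: pow_coord. Qed.

Let crd2 i : crd i \in Lfun gk 2%:E.
Proof.
have [/Lfun2P[_ g2] _ _] := gauss_moments R.
apply/Lfun2P; split => //.
rewrite (integral_law (mcrd i) (f := fun y : R => (y ^+ 2)%:E) _ (crd_law i))//.
by apply/measurable_EFinP; exact: measurable_funX.
Qed.

Let crd_mean i : ('E_gk[crd i] = 0)%E.
Proof.
have [_ g0 _] := gauss_moments R.
by rewrite -[RHS]g0 -(expectation_law (mcrd i) _ (crd_law i)).
Qed.

Let crd_cov i j : covariance gk (crd i) (crd j) = ((i == j)%:R%:E)%E.
Proof.
have [->|ij] := eqVneq i j.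
  have [_ _ <-] := gauss_moments R.
  by rewrite /variance -(covariance_law (mcrd j) _ _ (crd_law j)).
have := @independent_covariance _ _ _ _ _ gk _ (fun i w => tnth w i) i j idfun idfun.
apply=> //; first exact: (pow_independent (gauss R) k (@measurable_id _ _ setT)).
- exact: measurable_id.
- exact: measurable_id.
- exact: crd2.
- exact: crd2.
Qed.

Definition shifted t (z : k.-tuple R) : k.-tuple R :=
  [tuple t * h i 0 + (L *m colv z) i 0 | i < k].

Lemma shiftedE t z i : tnth (shifted t z) i = t * h i 0 + \sum_j L i j * tnth z j.
Proof. by rewrite tnth_mktuple mxE; congr (_ + _); apply: eq_bigr => j _; rewrite mxE. Qed.

Lemma measurable_shifted t : measurable_fun setT (shifted t).
Proof.
apply/measurable_fun_tnthP => i.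
rewrite (_ : _ \o _ = fun z => t * h i 0 + \sum_j L i j * tnth z j); last first.
  by apply/funext => z; exact: shiftedE.
apply: measurable_funD => //; apply: measurable_sum => j.
by apply: measurable_funM => //; exact: measurable_tnth.
Qed.

Definition shifted_law t : probability (k.-tuple R) R := law gk (measurable_shifted t).

Let lin i (z : k.-tuple R) : R := \sum_j L i j * crd j z.

Let lin2 i : lin i \in Lfun gk 2%:E.
Proof. by apply: Lfun2_lincomb. Qed.

Let shiftedE2 t i : crd i \o shifted t = (cst (t * h i 0) \+ lin i).
Proof. by apply/funext => z; rewrite /= /crd shiftedE. Qed.

Let shifted_Lfun2 t i : crd i \o shifted t \in Lfun gk 2%:E.
Proof. by rewrite shiftedE2 rpredD ?lee1n//= ?Lfun_cst ?lin2. Qed.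

(** The translation [t h] does not affect covariances, and [L] times standard noise has covariance
    [L L^T]. *)
Lemma shifted_law_PSigma t : in_PSigma S (shifted_law t).
Proof.
split=> [i|i j].
  have /Lfun2P[_ H] := shifted_Lfun2 t i; apply/Lfun2P; split; first exact: mcrd.
  apply: le_lt_trans H; rewrite le_eqVlt; apply/orP; left; apply/eqP/esym.
  apply: (integral_law (measurable_shifted t) (f := fun y => (crd i y ^+ 2)%:E) (P := gk)) => //.
  by apply/measurable_EFinP; exact: measurable_funX.
rewrite -(covariance_law (measurable_shifted t) (mcrd i) (mcrd j) (P := gk))//.
rewrite !shiftedE2.
rewrite covarianceDl; [|exact: Lfun_cst|exact: lin2|by rewrite -shiftedE2; exact: shifted_Lfun2].
rewrite covariance_cst_l add0e covarianceDr; [|exact: lin2|exact: Lfun_cst|exact: lin2].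
rewrite covariance_cst_r add0e /lin covariance_lincomb//.
under eq_bigr => l _.
  under eq_bigr => m _ do rewrite crd_cov -EFinM.
  rewrite sumEFin (bigD1 l)//= eqxx mulr1 big1 ?addr0 => [|m /negbTE ml]; last first.
    by rewrite eq_sym ml mulr0.
  rewrite -EFinM; over.
by rewrite sumEFin -LS mxE; congr EFin; apply: eq_bigr => l _; rewrite mxE.
Qed.

Lemma shifted_law_theta a t : theta a (shifted_law t) = t * (a^T *m h) 0 0.
Proof.
rewrite /theta mxE mulr_sumr; apply: eq_bigr => i _.
rewrite -(expectation_law (measurable_shifted t) (mcrd i) (P := gk))//.
rewrite shiftedE2 expectationD; [|exact: Lfun_cst|exact: Lfun21 (lin2 i)].
rewrite expectation_cst /lin expectation_lincomb// big1 => [|j _]; last first.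
  by rewrite crd_mean mule0.
by rewrite adde0 /= mxE mulrCA.
Qed.

End Model.

(** * Lower bound on the worst risk for a fixed allocation *)

Section Lower.
Variables (R : realType) (k : nat) (S : 'M[R]_k) (a h : 'cV[R]_k).
Hypothesis Spd : sym_posdef S.
Variables (coll : {set {set 'I_k}}) (n : {set 'I_k} -> nat).
Variable L : 'M[R]_k.
Hypothesis LS : L *m L^T = S.

(** The shortest [v] with [P_I L v = P_I h], written [A^T (A A^T)^-1 P_I h] for [A = P_I L], where
    [A A^T = Sigma_I]. *)
Definition noise_shift (I : {set 'I_k}) : 'cV[R]_k :=
  L^T *m ((projI R I)^T *m (invmx (SigI S I) *m (projI R I *m h))).

Lemma noise_shiftE (I : {set 'I_k}) i : i \in I -> (L *m noise_shift I) i 0 = h i 0.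
Proof.
apply: projI_eq; rewrite /noise_shift (mulmxA L) LS !mulmxA -/(SigI S I).
by rewrite mulmxV ?mul1mx// posdef_unitmx//; exact: SigI_posdef.
Qed.

Lemma noise_shift_sqnorm I : \sum_i noise_shift I i 0 ^+ 2 =
  ((projI R I *m h)^T *m invmx (SigI S I) *m (projI R I *m h)) 0 0.
Proof.
have Ipd := SigI_posdef Spd I.
rewrite -sqnorm_sum /noise_shift; move: (projI R I *m h) => y.
rewrite !trmx_mul !trmxK trmx_inv Ipd.1 -!mulmxA (mulmxA L) LS.
rewrite (mulmxA S) (mulmxA (projI R I)) (mulmxA (projI R I)) -/(SigI S I).
by rewrite mulKVmx// posdef_unitmx.
Qed.

Lemma sum_noise_shift_sqnorm :
  \sum_(p < ndata coll n) \sum_i noise_shift (patI p) i 0 ^+ 2 =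
  (h^T *m infomx S coll n *m h) 0 0.
Proof.
rewrite infomxE (sum_patI coll n (fun I => \sum_i noise_shift I i 0 ^+ 2)).
by apply: eq_bigr => I _; rewrite noise_shift_sqnorm mulr_natl.
Qed.

Variable f : (ndata coll n).-tuple (k.-tuple R) -> R.
Hypothesis mf : measurable_fun setT f.
Variable K : R.
Hypothesis worstK : (worst_mse S a f <= K%:E)%E.

Let N := ndata coll n.
Let P := power_prob (power_prob (gauss R) k) N.
Let X t (p : 'I_N) (w : N.-tuple (k.-tuple R)) := shifted L h t (tnth w p).
Let b := (a^T *m h) 0 0.

Lemma measurable_maskI (I : {set 'I_k}) : measurable_fun setT (@maskI R k I).
Proof.
apply/measurable_fun_tnthP => i; case: (boolP (i \in I)) => iI.
  rewrite (_ : _ \o _ = fun x => tnth x i); first exact: measurable_tnth.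
  by apply/funext => x; rewrite /= tnth_mktuple iI.
rewrite (_ : _ \o _ = cst 0)//.
by apply/funext => x; rewrite /= tnth_mktuple (negbTE iI).
Qed.

Let mX t p : measurable_fun setT (X t p).
Proof.
by apply: measurableT_comp; [exact: measurable_shifted|exact: measurable_tnth].
Qed.

Let mG t : measurable_fun setT (fun w => f (obs (X t) w)).
Proof.
apply: measurableT_comp => //; apply/measurable_fun_tnthP => p.
rewrite (_ : _ \o _ = maskI (patI p) \o X t p); last first.
  by apply/funext => w; rewrite /= tnth_mktuple.
by apply: measurableT_comp => //; exact: measurable_maskI.
Qed.

Let iidX t : iid_copies P (shifted_law L h t) (X t).
Proof.
have [_ ind] := pow_independent (power_prob (gauss R) k) N (measurable_shifted L h t).
split=> [p|p A mA|A mA]; [exact: mX| |exact: ind].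
apply: (pow_coord (power_prob (gauss R) k) p).
by rewrite -[_ @^-1` _]setTI; exact: measurable_shifted.
Qed.

Let risk t : (\int[P]_w ((f (obs (X t) w) - t * b) ^+ 2)%:E <= K%:E)%E.
Proof.
apply: le_trans worstK; apply: ereal_sup_ubound.
exists _, _, P, (shifted_law L h t), (X t); split; first exact: shifted_law_PSigma.
  exact: iidX.
by under [in RHS]eq_integral do rewrite shifted_law_theta.
Qed.

Let sh (d : R) : N.-tuple (k.-tuple R) -> N.-tuple (k.-tuple R) :=
  tmap (fun p : 'I_N => tmap (fun (i : 'I_k) (x : R) => x + d * noise_shift (patI p) i 0)).

Let lr (d : R) (w : N.-tuple (k.-tuple R)) : R :=
  \prod_p \prod_i gauss_ratio (d * noise_shift (patI p) i 0) (tnth (tnth w p) i).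

Let s := (h^T *m infomx S coll n *m h) 0 0.

(** [tilt_pow] is applied twice, over coordinates and then over samples; the exponents add up to
    [d^2] times the information in direction [h]. *)
Let sh_tilt d : tilt P (sh d) (lr d) (expR (s * d ^+ 2)).
Proof.
have -> : expR (s * d ^+ 2) =
    \prod_(p < N) \prod_i expR ((d * noise_shift (patI p) i 0) ^+ 2).
  rewrite /s -sum_noise_shift_sqnorm mulr_suml.
  rewrite (big_morph expR (@expRD R) (@expR0 R)); apply: eq_bigr => p _.
  rewrite mulr_suml (big_morph expR (@expRD R) (@expR0 R)); apply: eq_bigr => i _.
  by rewrite exprMn mulrC.
have T (p : 'I_N) := tilt_pow (fun i : 'I_k => gauss_tilt (d * noise_shift (patI p) i 0)).
exact: (tilt_pow T).
Qed.

(** On an observed coordinate, [L] maps the translation of the noise to [d h_i]; the other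
    coordinates are masked to 0 on both sides. *)
Let obs_shift t d w : obs (X (t + d)) w = obs (X t) (sh d w).
Proof.
apply: eq_from_tnth => p; rewrite !tnth_mktuple.
apply: eq_from_tnth => i; rewrite tnth_mktuple [RHS]tnth_mktuple; case: ifPn => // iI.
rewrite /X /sh !shiftedE tnth_mktuple -(noise_shiftE iI) mxE mulrDl -addrA; congr (_ + _).
rewrite mulr_sumr -big_split /=; apply: eq_bigr => j _.
by rewrite tnth_mktuple mulrDr addrC; congr (_ + _); rewrite mulrCA.
Qed.

Let s_ge0 : 0 <= s.
Proof.
rewrite /s infomxE sumr_ge0// => I _; rewrite mulr_ge0//.
exact: posdef_ge0 (posdef_inv (SigI_posdef Spd I)).
Qed.

Lemma worst_mse_bound_ge0 : 0 <= K.
Proof.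
rewrite -lee_fin; apply: le_trans (risk 0).
by apply: integral_ge0 => w _; rewrite lee_fin sqr_ge0.
Qed.

Lemma worst_mse_bound : (a^T *m h) 0 0 ^+ 2 <= K * (h^T *m infomx S coll n *m h) 0 0.
Proof.
apply: (@hcr_bound R _ _ P sh lr (fun t w => f (obs (X t) w))) => //.
by move=> t d w; rewrite obs_shift.
Qed.

End Lower.

(** * Matching the bounds: minimax risk, optimal variance and [VB] *)

Section Minimax.
Variables (R : realType) (k m : nat) (S : 'M[R]_k) (a : 'cV[R]_k).
Variables (coll : {set {set 'I_k}}) (c : {set 'I_k} -> 'I_m -> R) (B : 'I_m -> R).
Hypothesis Spd : sym_posdef S.

Lemma measurable_mppi_est (n : {set 'I_k} -> nat) (lam : weights R k) :
  measurable_fun setT (@mppi_est R k coll n lam).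
Proof.
rewrite /mppi_est; apply: measurable_sum => p; apply: measurable_funM => //.
rewrite (_ : (fun D => _) = fun D : (ndata coll n).-tuple (k.-tuple R) =>
  \sum_i ((lam (patI p))^T *m projI R (patI p)) 0 i * tnth (tnth D p) i); last first.
  by apply/funext => D; rewrite mxE; apply: eq_bigr => i _; rewrite [colv _ _ _]mxE.
apply: measurable_sum => i; apply: measurable_funM => //.
apply: (measurableT_comp (f := fun z : k.-tuple R => tnth z i)); exact: measurable_tnth.
Qed.

Lemma VB_le_worst_mse n (f : (ndata coll n).-tuple (k.-tuple R) -> R) :
  budget coll c B n -> measurable_fun setT f ->
  (VB coll c B S a <= worst_mse S a f)%E.
Proof.
move=> bn mf; have [L LS] := cholesky Spd.
have [cov|ncov] := pselect (supp_covered coll a n).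
  set V := (a^T *m Smat coll S n *m a) 0 0.
  apply: (@le_trans _ _ V%:E); first by apply: ereal_inf_lbound; exists n.
  have H K : (worst_mse S a f <= K%:E)%E -> V <= K.
    move=> fK; have K0 := worst_mse_bound_ge0 0 LS fK.
    have := worst_mse_bound (Smat coll S n *m a) Spd LS mf fK.
    have -> : (a^T *m (Smat coll S n *m a)) 0 0 = V by rewrite mulmxA.
    have -> : ((Smat coll S n *m a)^T *m infomx S coll n *m (Smat coll S n *m a)) 0 0 = V.
      rewrite -mulmxA infomx_range// -[LHS](mxE trmx_key (fun i j => _ j i)) -/(trmx _).
      by rewrite trmx_mul trmxK mulmxA.
    (* For [h = S(n) a] the bound reads [V^2 <= K V]; it is divided by [V] if [V > 0], and otherwise
       [V <= 0 <= K]. *)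
    by rewrite expr2; have [V0|V0] := leP V 0; [move=> _; exact: le_trans V0 K0|rewrite ler_pM2r].
  case E : (worst_mse S a f) => [r| |]; last 1 first.
  (* The value [-oo] would be below [V - 1], giving [V <= V - 1]. *)
  - by have := H (V - 1); rewrite E leNye lerBrDr gerDl ler10 => /(_ isT).
  - by rewrite lee_fin; apply: H; rewrite E.
  - by rewrite leey.
suff -> : worst_mse S a f = +oo%E by rewrite leey.
have [i ai iI] : exists2 i, a i 0 != 0 & forall I, I \in coll -> (0 < n I)%N -> i \notin I.
  apply: contrapT => H; apply: ncov => i ai; apply: contrapT => HI; apply: H.
  by exists i => // I Ic nI; apply/negP => iI; apply: HI; exists I.
(* The direction is the basis vector of an unobserved coordinate [i] with [a_i] nonzero: its
   information is 0, so a finite bound would give [a_i^2 <= 0]. *)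
have H K : ~ (worst_mse S a f <= K%:E)%E.
  move=> fK; have := worst_mse_bound (delta_mx i 0) Spd LS mf fK.
  rewrite infomxE big1 => [|I Ic]; last first.
    case: (posnP (n I)) => [->|nI]; first by rewrite mul0r.
    rewrite (_ : _ *m delta_mx i 0 = 0) ?mulmx0 ?mxE ?mulr0//.
    apply/matrixP => r j; rewrite projIE !mxE.
    case: eqP => // ri; have := iI I Ic nI; rewrite -ri enum_valP//.
  rewrite mulr0 -colE !mxE => a2.
  by move: ai; rewrite -sqrf_eq0 eq_le a2 sqr_ge0.
case E : (worst_mse S a f) => [r| |] => //.
  by have := H r; rewrite E lexx.
by have := H 0; rewrite E leNye.
Qed.

(** For each covered allocation, the optimally weighted estimator has the same risk [a^T S(n) a]
    under every law in the class; conversely [VB] bounds the worst risk of every estimator. *)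
Lemma minimax_risk_VB : minimax_risk coll c B S a = VB coll c B S a.
Proof.
apply/eqP; rewrite eq_le; apply/andP; split.
  apply: le_ereal_inf_tmp => _ [n [bn cov] <-].
  have U := opt_weights_unbiased Spd cov.
  apply: (@le_trans _ _ (worst_mse S a (@mppi_est R k coll n (opt_weights S coll n a)))).
    apply: ereal_inf_lbound; exists n; split => //.
    exists (@mppi_est R k coll n (opt_weights S coll n a)); split=> //.
    exact: measurable_mppi_est.
  apply: ge_ereal_sup => _ [d [Om [P [mu [X [muS iidX ->]]]]]].
  by rewrite (mppi_est_mse U muS iidX) opt_weights_obj.
by apply: le_ereal_inf_tmp => _ [n [bn [f [mf ->]]]]; exact: VB_le_worst_mse.
Qed.

(** For a fixed allocation, minimising over unbiased weights gives [a^T S(n) a], so the joint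
    minimum is the minimum of these values over covered allocations. *)
Lemma MultiPPI_obj_VB n lam : is_MultiPPI coll c B S a n lam ->
  (mppi_obj coll S n lam)%:E = VB coll c B S a.
Proof.
move=> [bn U opt]; apply/eqP; rewrite eq_le; apply/andP; split.
  apply: le_ereal_inf_tmp => _ [n' [bn' cov'] <-]; rewrite lee_fin.
  by rewrite -(opt_weights_obj Spd cov'); apply: opt => //; exact: opt_weights_unbiased.
apply: (@le_trans _ _ ((a^T *m Smat coll S n *m a) 0 0)%:E).
  apply: ereal_inf_lbound; exists n => //; split => //; exact: unbiasedU_covered U.
by rewrite lee_fin; exact: mppi_obj_ge.
Qed.

End Minimax.

Theorem theorem1 (R : realType) (k m : nat) (Sigma : 'M[R]_k) (a : 'cV[R]_k)
  (coll : {set {set 'I_k}}) (c : {set 'I_k} -> 'I_m -> R) (B : 'I_m -> R) :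
  sym_posdef Sigma ->
  a != 0 ->
  (forall I, I \in coll -> I != finset.set0) ->
  (forall I t, I \in coll -> 0 <= c I t) ->
  (forall t, 0 <= B t) ->
  (exists n, budget coll c B n /\ supp_covered coll a n) ->
  minimax_risk coll c B Sigma a = VB coll c B Sigma a /\
  (forall n lam, is_MultiPPI coll c B Sigma a n lam ->
     forall d (Omega : measurableType d) (P : probability Omega R)
       (mu : probability (k.-tuple R) R)
       (X : 'I_(ndata coll n) -> Omega -> k.-tuple R),
     in_PSigma Sigma mu -> iid_copies P mu X ->
     'V_P[fun w => mppi_est (n:=n) lam (obs X w)] = VB coll c B Sigma a).
Proof.
move=> Spd _ _ _ _ _; split; first exact: minimax_risk_VB.
move=> n lam opt d Om P mu X muS iidX.
by rewrite (mppi_est_variance lam muS iidX) (MultiPPI_obj_VB Spd opt).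
Qed.
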